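(* Let $G$ be a connected biquiver with vertices $1,\dots,t$. The following are equivalent: (i) $G$ is representation-finite; (ii) the underlying undirected graph of $G$ (forget directions and the full/dashed distinction) is one of the Dynkin diagrams $A_t$ ($t\ge1$), $D_t$ ($t\ge4$), $E_6$, $E_7$, $E_8$; equivalently, $G$ is obtained from one of these diagrams by replacing each edge with a full or dashed arrow, in either direction; (iii) the Tits form $q_G$ is positive definite.
   Context: A biquiver is a finite directed graph $G$ with vertices $1,\dots,t$, in which loops and multiple arrows are allowed and each arrow is either full ($u\longrightarrow v$) or dashed ($u\dashrightarrow v$). A map $\mathcal A:U\to V$ between complex vector spaces is semilinear if $\mathcal A(u+u')=\mathcal Au+\mathcal Au'$ and $\mathcal A(\alpha u)=\bar\alpha\,\mathcal Au$ for all $u,u'\in U$ and $\alpha\in\mathbb C$. A representation $\mathcal A$ of $G$ consists of the following data: - a finite-dimensional complex vector space $\mathcal A_v$ for each vertex $v$; - a linear map $\mathcal A_\alpha:\mathcal A_u\to\mathcal A_v$ for each full arrow $\alpha:u\to v$; - a semilinear map $\mathcal A_\alpha:\mathcal A_u\to\mathcal A_v$ for each dashed arrow $\alpha:u\dashrightarrow v$. Its dimension is $(\dim\mathcal A_1,\dots,\dim\mathcal A_t)$. A morphism $\mathcal F:\mathcal A\to\mathcal B$ is a family of linear maps $\mathcal F_v:\mathcal A_v\to\mathcal B_v$ such that $\mathcal B_\alpha\mathcal F_u=\mathcal F_v\mathcal A_\alpha$ for every arrow $\alpha$ from $u$ to $v$. It is an isomorphism if all $\mathcal F_v$ are bijective.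 The direct sum $\mathcal A\oplus\mathcal B$ has spaces $\mathcal A_v\oplus\mathcal B_v$ and maps $\mathcal A_\alpha\oplus\mathcal B_\alpha$. A representation is indecomposable if its dimension is nonzero and it is not isomorphic to a direct sum of two representations of nonzero dimension. $G$ is representation-finite if it has only finitely many isomorphism classes of indecomposable representations. The Tits form of $G$ is $q_G(x_1,\dots,x_t)=x_1^2+\dots+x_t^2-\sum x_ux_v$, where the sum runs over all arrows (full or dashed, including loops) $u\to v$ of $G$. The Dynkin diagrams, as undirected graphs, are: - $A_t$: the path with $t$ vertices; - $D_t$ ($t\ge4$): a path with $t-2$ vertices, with two extra pendant vertices attached to one end vertex; - $E_6$, $E_7$, $E_8$: trees consisting of a central vertex from which three paths emanate, of lengths (numbers of edges) $(1,2,2)$, $(1,2,3)$, $(1,2,4)$ respectively. *)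

(* Defs.v *)
From HB Require Import structures.
From mathcomp Require Import all_boot all_order all_algebra.
Set Implicit Arguments. Unset Strict Implicit. Unset Printing Implicit Defensive.
Import Order.TTheory GRing.Theory Num.Theory.
Local Open Scope ring_scope.

(* A biquiver on vertices 'I_t (= {1..t} shifted to {0..t-1}):
   a finite family of arrows a : 'I_narr, with source, target and
   a flag [full a] (true = full arrow, false = dashed arrow).
   Loops and multiple arrows are allowed. *)
Record biquiver (t : nat) := Biquiver {
  narr : nat;
  src : 'I_narr -> 'I_t;
  tgt : 'I_narr -> 'I_t;
  full : 'I_narr -> bool }.
Arguments narr {t} b.
Arguments src {t} b _.
Arguments tgt {t} b _.
Arguments full {t} b _.

Section Reps.
Variables (C : numClosedFieldType) (t : nat) (G : biquiver t).

(* A representation: the space at v is C^(rdim v) (column vectors).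
   A full arrow a : u -> v acts by x |-> M x, a dashed arrow by
   x |-> M (conj x), where M = rmap a. *)
Record rep := Rep {
  rdim : 'I_t -> nat;
  rmap : forall a : 'I_(narr G), 'M[C]_(rdim (tgt G a), rdim (src G a)) }.

Definition conj_mx m n (M : 'M[C]_(m, n)) : 'M[C]_(m, n) := map_mx Num.conj M.

(* F : A -> B is a morphism: B_a F_u = F_v A_a as maps; for a dashed arrow
   this reads  M_B (conj F_u) = F_v M_A  on matrices. *)
Definition is_morphism (A B : rep)
  (F : forall v : 'I_t, 'M[C]_(rdim B v, rdim A v)) : Prop :=
  forall a : 'I_(narr G),
    rmap B a *m (if full G a then F (src G a) else conj_mx (F (src G a)))
    = F (tgt G a) *m rmap A a.

Definition rep_iso (A B : rep) : Prop :=
  exists F : forall v : 'I_t, 'M[C]_(rdim B v, rdim A v),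
    is_morphism F /\
    forall v : 'I_t, exists Finv : 'M[C]_(rdim A v, rdim B v),
      Finv *m F v = 1%:M /\ F v *m Finv = 1%:M.

Definition rep_dsum (A B : rep) : rep :=
  @Rep (fun v => (rdim A v + rdim B v)%N)
       (fun a => block_mx (rmap A a) 0 0 (rmap B a)).

Definition rep_nonzero (A : rep) : Prop := exists v : 'I_t, rdim A v != 0%N.

Definition indecomposable (A : rep) : Prop :=
  rep_nonzero A /\
  ~ (exists B B' : rep, rep_nonzero B /\ rep_nonzero B' /\ rep_iso A (rep_dsum B B')).

Definition rep_finite : Prop :=
  exists (n : nat) (f : 'I_n -> rep),
    forall A : rep, indecomposable A -> exists i : 'I_n, rep_iso A (f i).

Definition tits_form (x : 'I_t -> C) : C :=
  \sum_(i < t) x i ^+ 2 - \sum_(a < narr G) x (src G a) * x (tgt G a).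

Definition tits_pos_def : Prop :=
  forall x : 'I_t -> C, (forall i, x i \is Num.real) -> (exists i, x i != 0) ->
    0 < tits_form x.

End Reps.

Arguments rep_finite C [t] G.
Arguments tits_pos_def C [t] G.

Definition und_adj t (G : biquiver t) (u v : 'I_t) : bool :=
  [exists a : 'I_(narr G), ((src G a == u) && (tgt G a == v))
                        || ((src G a == v) && (tgt G a == u))].

Definition connected_biquiver t (G : biquiver t) : Prop :=
  (0 < t)%N /\ forall u v : 'I_t, connect (@und_adj t G) u v.

Definition n_arrows_between t (G : biquiver t) (u v : 'I_t) : nat :=
  #|[pred a : 'I_(narr G) | ((src G a == u) && (tgt G a == v))
                         || ((src G a == v) && (tgt G a == u))]|.

Inductive dynkin_type := DynA | DynD | DynE6 | DynE7 | DynE8.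

Definition path_edge (m i j : nat) : bool :=
  ((i.+1 == j) || (j.+1 == i)) && (maxn i j < m)%N.

Definition extra_edge (p q i j : nat) : bool :=
  ((i == p) && (j == q)) || ((i == q) && (j == p)).

Definition dynkin_ok (X : dynkin_type) (t : nat) : bool :=
  match X with
  | DynA => (1 <= t)%N
  | DynD => (4 <= t)%N
  | DynE6 => t == 6%N
  | DynE7 => t == 7%N
  | DynE8 => t == 8%N
  end.

(* A_t : path 0 - 1 - ... - (t-1).
   D_t : path 0 - ... - (t-3) with pendants t-2 and t-1 attached to t-3.
   E_n : path 0 - ... - (n-2) with pendant n-1 attached to 2
         (arms of lengths 1, 2, n-4 from the central vertex 2). *)
Definition dynkin_edge (X : dynkin_type) (t i j : nat) : bool :=
  match X with
  | DynA => path_edge t i j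
  | DynD => path_edge t.-1 i j || extra_edge (t - 3) t.-1 i j
  | DynE6 | DynE7 | DynE8 => path_edge t.-1 i j || extra_edge 2 t.-1 i j
  end.

(* G is obtained from a Dynkin diagram by replacing each edge by exactly one
   (full or dashed) arrow in either direction: the underlying undirected
   multigraph (with loops) of G is isomorphic to the Dynkin diagram. *)
Definition dynkin_biquiver t (G : biquiver t) : Prop :=
  exists X : dynkin_type, dynkin_ok X t /\
  exists sigma : 'I_t -> 'I_t, bijective sigma /\
    forall u v : 'I_t,
      n_arrows_between G u v = nat_of_bool (dynkin_edge X t (sigma u) (sigma v)).

(* Main.v *)
Require Import Defs.
From HB Require Import structures.
From mathcomp Require Import all_boot all_order all_algebra.
From mathcomp Require Import ring lra zify.
From mathcomp Require Import mpoly.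
From Stdlib Require Import Classical FunctionalExtensionality.

(* All three conditions are compared with weak positivity of the Tits form:
   [q d > 0] for every nonzero dimension vector [d] of natural numbers.

   Representation-finite => weakly positive (Tits).  The representations of
   dimension [d] form a real vector space of dimension
   [2 * sum_(u -> v) d u * d v], on which a real group of dimension
   [2 * sum_v d v ^ 2] acts, with the nonzero real scalars acting trivially (the
   complex ones do not, because of the dashed arrows).  Finitely many orbits
   force [q d > 0]: an isomorphism with one real coordinate normalized to 1
   gives a rational parametrization of an orbit by too few parameters, and
   counting monomials yields a nonzero polynomial vanishing on all the orbits.

   Weakly positive => Dynkin.  Starting from one vertex and adding adjacent
   vertices one at a time, the full subgraph stays Dynkin, as otherwise it
   contains an extended Dynkin diagram, whose null root contradicts positivity.
   All Dynkin diagrams are "combs": a path with one pendant vertex.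

   Dynkin => positive definite.  Completing squares along the three arms.

   Dynkin => representation-finite.  On a tree, replacing the spaces at some
   vertices by their complex conjugates makes all arrows full.  Then every
   indecomposable [A] has [End A = C] (Ringel), so
   [q (dim A) = dim End A - dim Ext^1 (A, A) <= 1]; hence [Ext^1 (A, A) = 0] and
   [q (dim A) = 1].  There are finitely many such dimension vectors, and two
   representations of the same dimension without self-extensions are isomorphic,
   both being isomorphic to almost all points of the line joining them. *)

Set Implicit Arguments. Unset Strict Implicit. Unset Printing Implicit Defensive.
Import Order.TTheory GRing.Theory Num.Theory.
Local Open Scope ring_scope.

(** * Representations of quivers *)

Section GeneralizedInverse.
Variable F : fieldType.

(** Representations act on columns, so the kernel meant is that of [x |-> T *m x]; this is an
    idempotent with that kernel as its image. *)
Definition kerproj m n (T : 'M[F]_(m, n)) : 'M_n := 1%:M - pinvmx T *m T.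

Lemma mul_kerproj m n (T : 'M[F]_(m, n)) : T *m kerproj T = 0.
Proof. by rewrite mulmxBr mulmx1 mulmxA mulmxKpV ?subrr. Qed.

Lemma kerproj_id m n k (T : 'M[F]_(m, n)) (X : 'M_(n, k)) :
  T *m X = 0 -> kerproj T *m X = X.
Proof. by move=> TX; rewrite mulmxBl mul1mx -mulmxA TX mulmx0 subr0. Qed.

Lemma kerproj_factor m n k (T : 'M[F]_(m, n)) (H : 'M_(k, n)) :
  H *m kerproj T = 0 -> H = (H *m pinvmx T) *m T.
Proof. by move/eqP; rewrite mulmxBr mulmx1 mulmxA subr_eq0 => /eqP. Qed.

Lemma kerproj_idem m n (T : 'M[F]_(m, n)) : kerproj T *m kerproj T = kerproj T.
Proof. exact/kerproj_id/mul_kerproj. Qed.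

(** Rank factorization [e = c *m r]: cancelling the full-rank outer factors in
    [c *m r *m c *m r = c *m r] leaves [r *m c = 1]. *)
Lemma idempotent_factor n (e : 'M[F]_n) : e *m e = e ->
  exists ip : 'M_(n, \rank e) * 'M_(\rank e, n),
    ip.1 *m ip.2 = e /\ ip.2 *m ip.1 = 1%:M.
Proof.
move=> ee.
have/row_fullP[Y] := col_base_full e.
have/row_freeP[X] : row_free (row_base e) by exact: row_base_free.
move: (col_base e) (row_base e) (mulmx_base e) => c r cr rX Yc.
exists (c, r); split => //=.
have H : c *m (r *m c) *m r = c *m r by rewrite mulmxA -mulmxA !cr.
have := congr1 (fun M => Y *m M *m X) H.
by rewrite /= !mulmxA Yc !mul1mx -!mulmxA rX !mulmx1.
Qed.

Lemma idempotent_full n (e : 'M[F]_n) : e *m e = e -> \rank e = n -> e = 1%:M.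
Proof.
move=> ee re; have/row_freeP[X eX] : row_free e by rewrite /row_free re.
by rewrite -[LHS]mulmx1 -eX mulmxA ee.
Qed.

(** Fitting decomposition: under the rank condition the space is the direct sum of the image and the
    kernel of [T], and [e] projects onto the image along the kernel. Being both a left and a right
    multiple of [T] makes it compatible with the arrows later. *)
Lemma rank_sqr_group n (T : 'M[F]_n) : \rank (T *m T) = \rank T ->
  exists e X Y, [/\ e = Y *m T, e = T *m X, e *m T = T, T *m e = T & e *m e = e].
Proof.
move=> rT.
have [Y TY] : exists Y, T = Y *m (T *m T).
  apply/submxP; have := mxrank_leqif_sup (submxMl T T); case=> _.
  by rewrite rT eqxx.
have [X TX] : exists X, T = (T *m T) *m X.
  have [X TX] : exists X, T^T = X *m (T *m T)^T.
    apply/submxP; rewrite trmx_mul; have := mxrank_leqif_sup (submxMl T^T T^T).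
    by case=> _; rewrite -trmx_mul !mxrank_tr rT eqxx.
  by exists X^T; apply: trmx_inj; rewrite {1}TX [in RHS]trmx_mul trmxK.
have YX : Y *m T = T *m X by rewrite [in LHS]TX mulmxA -TY.
exists (Y *m T), X, Y. split; rewrite ?YX //.
- by rewrite -YX -mulmxA -TY.
- by rewrite mulmxA -TX.
- by rewrite -{1}YX -!mulmxA (mulmxA T T) -TX YX.
Qed.

End GeneralizedInverse.

Section LinearRepresentations.
Variables (C : numClosedFieldType) (t : nat) (G : biquiver t).

Implicit Types A B U K : rep C G.

Definition fam A B := forall v, 'M[C]_(rdim B v, rdim A v).

(* The representations of the quiver obtained from [G] by making all arrows full. *)
Definition lin_morphism A B (F : fam A B) :=
  forall a, rmap B a *m F (src G a) = F (tgt G a) *m rmap A a.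

Definition lin_iso A B := exists F : fam A B, lin_morphism F /\
  forall v, exists Finv : 'M[C]_(rdim A v, rdim B v),
    Finv *m F v = 1%:M /\ F v *m Finv = 1%:M.

Definition fam_comp A B K (F : fam B K) (H : fam A B) : fam A K :=
  fun v => F v *m H v.

Definition fam1 A : fam A A := fun v => 1%:M.

(** Phrased with idempotent endomorphisms, each of which yields a summand by [idempotent_split]. *)
Definition lin_indecomposable A := rep_nonzero A /\
  forall e : fam A A, lin_morphism e -> (forall v, e v *m e v = e v) ->
    (forall v, e v = 0) \/ (forall v, e v = 1%:M).

(** This is [Ext^1 (A, A) = 0]: every family of maps along the arrows is a coboundary. *)
Definition rigid A :=
  forall xi : (forall a, 'M[C]_(rdim A (tgt G a), rdim A (src G a))),
  exists h : fam A A, forall a,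
    xi a = h (tgt G a) *m rmap A a - rmap A a *m h (src G a).

Definition fdim A := (\sum_v rdim A v)%N.
Definition frank A B (F : fam A B) := (\sum_v \rank (F v))%N.

Lemma lin_morphism_comp A B K (F : fam B K) (H : fam A B) :
  lin_morphism F -> lin_morphism H -> lin_morphism (fam_comp F H).
Proof. by move=> mF mH a; rewrite /fam_comp mulmxA mF -!mulmxA mH. Qed.

Lemma frank_eq0 A B (F : fam A B) : frank F = 0%N -> forall v, F v = 0.
Proof.
move=> /eqP; rewrite sum_nat_eq0 => /forallP H v; apply/eqP.
by rewrite -mxrank_eq0 (eqP (implyP (H v) isT)).
Qed.

Lemma leq_sum_eq (I : finType) (f g : I -> nat) : (forall i, f i <= g i)%N ->
  (\sum_i g i <= \sum_i f i)%N -> forall i, f i = g i.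
Proof.
move=> fg H i; apply/eqP; rewrite eqn_leq fg /= leqNgt; apply/negP => lt.
move: H; rewrite leqNgt => /negP; apply.
rewrite (bigD1 i) //= [X in (_ < X)%N](bigD1 i) //= -addSn leq_add //.
exact: leq_sum.
Qed.

Lemma idempotent_split A (e : fam A A) :
  lin_morphism e -> (forall v, e v *m e v = e v) ->
  exists U (i : fam U A) (p : fam A U),
    [/\ lin_morphism i, lin_morphism p, forall v, p v *m i v = 1%:M,
        forall v, i v *m p v = e v & forall v, rdim U v = \rank (e v)].
Proof.
move=> me ee.
have [ip ipE] := fin_all_exists (fun v => idempotent_factor (ee v)).
pose i v := (ip v).1; pose p v := (ip v).2.
have ipe v : i v *m p v = e v by case: (ipE v).
have pi1 v : p v *m i v = 1%:M by case: (ipE v).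
move: i p ipe pi1 => i p ipe pi1 {ip ipE}.
have ei v : e v *m i v = i v.
  by have := congr1 (mulmx (i v)) (pi1 v); rewrite mulmxA ipe mulmx1.
have pe v : p v *m e v = p v.
  by have := congr1 (mulmx^~ (p v)) (pi1 v); rewrite /= -mulmxA ipe mul1mx.
exists (@Rep C t G (fun v => \rank (e v))
         (fun a => p (tgt G a) *m rmap A a *m i (src G a))), i, p.
split=> // a /=.
- by rewrite !mulmxA ipe -me -mulmxA ei.
- by rewrite -!mulmxA ipe me mulmxA pe.
Qed.

(** The inclusion [i] is a morphism, whereas the retraction [p] is chosen vertex by vertex and need
    not be one. *)
Lemma kernel_exists A (T : fam A A) : lin_morphism T ->
  exists K (i : fam K A) (p : fam A K),
    [/\ lin_morphism i, forall v, p v *m i v = 1%:M,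
        forall v, i v *m p v = kerproj (T v) &
        forall v, rdim K v = \rank (kerproj (T v))].
Proof.
move=> mT; pose e v := kerproj (T v).
have ee v : e v *m e v = e v by exact: kerproj_idem.
have [ip ipE] := fin_all_exists (fun v => idempotent_factor (ee v)).
pose i v := (ip v).1; pose p v := (ip v).2.
have ipe v : i v *m p v = e v by case: (ipE v).
have pi1 v : p v *m i v = 1%:M by case: (ipE v).
move: i p ipe pi1 => i p ipe pi1 {ip ipE}.
have Ti v : T v *m i v = 0.
  have := congr1 (fun M => T v *m (i v *m M)) (pi1 v).
  by rewrite /= (mulmxA (i v)) ipe mulmxA mul_kerproj mul0mx mulmx1.
exists (@Rep C t G (fun v => \rank (e v))
         (fun a => p (tgt G a) *m rmap A a *m i (src G a))), i, p.
split=> // a /=.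
rewrite !mulmxA ipe -mulmxA kerproj_id //.
by rewrite mulmxA -mT -mulmxA Ti mulmx0.
Qed.

Lemma mxrank_kerproj n (T : 'M[C]_n) : (\rank (kerproj T) + \rank T = n)%N.
Proof.
have P1 : kerproj T + pinvmx T *m T = 1%:M by rewrite subrK.
set P := pinvmx T *m T in P1.
have rP : \rank P = \rank T.
  apply/eqP; rewrite eqn_leq mxrankM_maxr /=.
  by rewrite -{1}[T](@mulmxKpV _ _ _ _ T T) // -mulmxA mxrankM_maxr.
apply/eqP; rewrite eqn_leq; apply/andP; split; last first.
  by rewrite -{1}(mxrank1 C n) -P1 -rP mxrank_add.
rewrite addnC -rP; have := mxrank_mul_min P (kerproj T).
by rewrite /P -mulmxA mul_kerproj mulmx0 mxrank0 leqn0 subn_eq0.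
Qed.

End LinearRepresentations.

(** * Families of matrices as row vectors *)

Section Vectorization.
Variables (K : finType) (p q : K -> nat).

Definition entry_index : finType := {k : K & 'I_(p k) * 'I_(q k)}%type.

Lemma card_entry_index : #|entry_index| = (\sum_k p k * q k)%N.
Proof.
rewrite card_tagged sumnE big_map big_enum /=.
by apply: eq_bigr => k _; rewrite card_prod !card_ord.
Qed.

Section Ring.
Variable R : pzRingType.

Definition vec (F : forall k, 'M[R]_(p k, q k)) : 'rV_#|entry_index| :=
  \row_i F (tag (enum_val i)) (tagged (enum_val i)).1 (tagged (enum_val i)).2.

Definition unvec (r : 'rV[R]_#|entry_index|) k : 'M[R]_(p k, q k) :=
  \matrix_(i, j) r 0 (enum_rank (Tagged (fun k => 'I_(p k) * 'I_(q k))%type (i, j))).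

Lemma vecK F k : unvec (vec F) k = F k.
Proof. by apply/matrixP => i j; rewrite !mxE enum_rankK. Qed.

Lemma unvecK r : vec (unvec r) = r.
Proof.
apply/rowP => i; rewrite !mxE; congr (r 0 _); apply: (canLR (enum_valK)).
by case: (enum_val i) => k [].
Qed.

Lemma unvecP x r s k : unvec (x *: r + s) k = x *: unvec r k + unvec s k.
Proof. by apply/matrixP => i j; rewrite !mxE. Qed.

Lemma eq_vec F H : (forall k, F k = H k) -> vec F = vec H.
Proof. by move=> FH; apply/rowP => i; rewrite !mxE FH. Qed.

Lemma vecP x F H : vec (fun k => x *: F k + H k) = x *: vec F + vec H.
Proof. by apply/rowP => i; rewrite !mxE. Qed.
End Ring.

Lemma map_unvec (R S : pzRingType) (f : {rmorphism R -> S}) r k :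
  map_mx f (unvec r k) = unvec (map_mx f r) k.
Proof. by apply/matrixP => i j; rewrite !mxE. Qed.
End Vectorization.

(** In characteristic zero the first [size p] natural numbers are too many distinct roots. *)
Lemma poly_nonroot (R : numDomainType) (p : {poly R}) : p != 0 ->
  exists n : nat, p.[n%:R] != 0.
Proof.
move=> p0; apply: NNPP => H.
have allr : all (root p) [seq n%:R | n <- iota 0 (size p)].
  apply/allP => _ /mapP[n _ ->]; rewrite /root; apply/negPn/negP => pn.
  by apply: H; exists n.
have := max_poly_roots p0 allr; rewrite size_map size_iota ltnn.
move=> H'; suff: false by []; apply: H'.
by rewrite map_inj_uniq ?iota_uniq // => m n /eqP; rewrite eqr_nat => /eqP.
Qed.

(** * The coboundary and generic isomorphisms of rigid representations *)

Section Orbits.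
Variables (C : numClosedFieldType) (t : nat) (G : biquiver t).
Variable d : 'I_t -> nat.

Definition maps := forall a, 'M[C]_(d (tgt G a), d (src G a)).
Local Notation Fam := (forall v, 'M[C]_(d v, d v)).

Local Notation nE := #|entry_index (fun a : 'I_(narr G) => d (tgt G a)) (fun a => d (src G a))|.
Local Notation "[ 'vecV' F ]" := (vec (p := d) (q := d) F).
Local Notation "[ 'vecE' F ]" :=
  (vec (p := fun a => d (tgt G a)) (q := fun a => d (src G a)) F).

(* The coboundary [F |-> (F_v A_a - B_a F_u)_a]; its kernel is [Hom (A, B)]
   and its cokernel is [Ext^1 (A, B)]. *)
Definition cobd (A B : maps) (r : 'rV[C]_#|entry_index d d|) :=
  [vecE fun a => unvec r (tgt G a) *m A a - B a *m unvec r (src G a)].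

Lemma cobd_linear A B : linear (cobd A B).
Proof.
move=> x r s; rewrite /cobd -vecP; apply: eq_vec => a.
rewrite !unvecP mulmxDl mulmxDr -scalemxAl -scalemxAr scalerBr.
by rewrite opprD addrACA.
Qed.

HB.instance Definition _ A B :=
  GRing.isLinear.Build C _ _ _ (cobd A B) (cobd_linear A B).

Definition cobd_mx A B := lin1_mx (cobd A B).

Lemma cobd_mxE A B (F : Fam) : [vecV F] *m cobd_mx A B =
  [vecE fun a => F (tgt G a) *m A a - B a *m F (src G a)].
Proof. by rewrite mul_rV_lin1 /= /cobd; apply: eq_vec => a; rewrite !vecK. Qed.

Local Notation rep_of := (@Rep C t G d).

Lemma cobd_mx_eq0 A B (F : Fam) : [vecV F] *m cobd_mx A B = 0 ->
  lin_morphism (F : fam (rep_of A) (rep_of B)).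
Proof.
rewrite cobd_mxE => H a; apply/esym/eqP; rewrite -subr_eq0; apply/eqP.
rewrite -[LHS](vecK (fun a => F (tgt G a) *m A a - B a *m F (src G a))) H.
by apply/matrixP => i j; rewrite !mxE.
Qed.

Lemma rigidP A : rigid (rep_of A) <-> row_full (cobd_mx A A).
Proof.
split=> [rA | /row_fullP[R RL] xi].
  apply/row_fullP; pose e (i : 'I_nE) : 'rV[C]_nE := delta_mx 0 i.
  have H i : exists h, h *m cobd_mx A A = e i.
    have [h hE] := rA (unvec (e i)).
    exists [vecV h]; rewrite cobd_mxE -[RHS]unvecK.
    by apply: eq_vec => a; rewrite hE.
  have [h hE] := fin_all_exists H.
  exists (\matrix_i h i); apply/row_matrixP => i.
  by rewrite row_mul rowK hE rowE mulmx1.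
exists (unvec ([vecE xi] *m R)) => a.
have := cobd_mxE A A (unvec ([vecE xi] *m R)).
rewrite unvecK -mulmxA RL mulmx1 => /(congr1 (fun r => unvec r a)).
by rewrite !vecK.
Qed.

(** The coboundary from [A] to the point [X s] of the line has matrix [L0 + s *: L1], onto at
    [s = 0]. Solving its kernel equation by Cramer's rule gives morphisms [A -> X s], polynomial in
    [s] and equal to the identity at [0]; [P] is the product of their determinants. *)
Lemma rigid_generic (A B : maps) : rigid (rep_of A) ->
  exists2 P : {poly C}, P.[0] != 0 & forall s, P.[s] != 0 ->
    lin_iso (rep_of A) (rep_of (fun a => A a + s *: (B a - A a))).
Proof.
move=> /rigidP/row_fullP[R RL].
pose X s a := A a + s *: (B a - A a).
pose zero : maps := fun a => 0.
pose L0 := cobd_mx A A; pose L1 := cobd_mx zero (fun a => B a - A a).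
have LX s : cobd_mx A (X s) = L0 + s *: L1.
  apply/row_matrixP => i; rewrite !rowE mulmxDr -scalemxAr -[delta_mx _ _](unvecK).
  rewrite !cobd_mxE addrC -vecP; apply: eq_vec => a.
  rewrite /X /zero mulmx0 sub0r mulmxDl -scalemxAl scalerN opprD.
  by rewrite [RHS]addrC addrA.
pose Lp := map_mx polyC L0 + 'X *: map_mx polyC L1.
have evL (s : C) : map_mx (horner_eval s) Lp = cobd_mx A (X s).
  apply/matrixP => i j; rewrite LX !mxE /horner_eval !hornerE //.
pose one := [vecV fun v => 1%:M] : 'rV[C]_#|entry_index d d|.
pose Rp := map_mx polyC R; pose M := Rp *m Lp.
pose onep := map_mx polyC one.
(* Since [\adj M *m Rp *m Lp = \det M], the subtracted term cancels the coboundary of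
   [\det M *: onep]. At [0] that coboundary already vanishes and [M] is the identity. *)
pose Fp := \det M *: onep - onep *m Lp *m \adj M *m Rp.
have FpL : Fp *m Lp = 0.
  rewrite mulmxBl -scalemxAl -(mulmxA _ Rp) -/M -(mulmxA _ (\adj M)) mul_adj_mx.
  by rewrite mul_mx_scalar subrr.
have evc s m n (T : 'M[C]_(m, n)) : map_mx (horner_eval s) (map_mx polyC T) = T.
  by apply/matrixP => i j; rewrite !mxE /horner_eval hornerC.
pose Fs s := map_mx (horner_eval s) Fp.
have Fs0 : Fs 0 = one.
  have X0 a : X 0 a = A a by rewrite /X scale0r addr0.
  have L00 : map_mx (horner_eval 0) Lp = L0.
    by apply/matrixP => i j; rewrite !mxE /horner_eval !hornerE // mul0r addr0.
  have oneL : one *m L0 = 0.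
    rewrite cobd_mxE (@eq_vec _ _ _ _ _ (fun a => 0)) => [|a].
      by apply/rowP => i; rewrite !mxE.
    by rewrite mul1mx mulmx1 subrr.
  rewrite /Fs /Fp map_mxB map_mxZ !map_mxM /= !evc L00 oneL !mul0mx subr0.
  by rewrite /horner_eval -horner_evalE -det_map_mx map_mxM /= evc L00 RL det1 scale1r.
exists (\prod_v \det (unvec Fp v)).
  rewrite -[_.[0]]/(horner_eval 0 _) rmorph_prod; apply/prodf_neq0 => v _.
  by rewrite -det_map_mx map_unvec -/(Fs 0) Fs0 vecK det1 oner_neq0.
move=> s; rewrite -[_.[s]]/(horner_eval s _) rmorph_prod => /prodf_neq0 ds.
exists (unvec (Fs s)); split.
  apply: cobd_mx_eq0; rewrite unvecK -/(X s) -evL -map_mxM FpL.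
  exact: map_mx0.
move=> v; exists (invmx (unvec (Fs s) v)).
have u : unvec (Fs s) v \in unitmx.
  by rewrite unitmxE unitfE -map_unvec det_map_mx ds.
by rewrite mulVmx // mulmxV.
Qed.

Lemma lin_iso_sym (A B : rep C G) : lin_iso A B -> lin_iso B A.
Proof.
case=> F [mF /fin_all_exists[H HE]]; exists H; split => [a|v]; last first.
  by exists (F v); case: (HE v).
have [HF _] := HE (tgt G a); have [_ FH] := HE (src G a).
by rewrite -[LHS]mul1mx -HF -mulmxA (mulmxA (F _)) -mF -!mulmxA FH mulmx1.
Qed.

Lemma lin_iso_trans (A B K : rep C G) : lin_iso A B -> lin_iso B K -> lin_iso A K.
Proof.
case=> F [mF /fin_all_exists[F' FE]] [H [mH /fin_all_exists[H' HE]]].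
exists (fam_comp H F); split; first exact: lin_morphism_comp.
move=> v; exists (F' v *m H' v); have [? FF] := FE v; have [HH ?] := HE v.
by rewrite /fam_comp -mulmxA (mulmxA _ (H v)) HH mul1mx -mulmxA (mulmxA (F v)) FF mul1mx.
Qed.

Lemma rigid_iso (A B : maps) :
  rigid (rep_of A) -> rigid (rep_of B) -> lin_iso (rep_of A) (rep_of B).
Proof.
move=> /(rigid_generic B)[P P0 PA] /(rigid_generic A)[Q Q0 QB].
(* Composing with [1 - 'X] parametrizes the line from the other end; a natural number that is a root
   of neither factor gives a point isomorphic to both [A] and [B]. *)
have : P * (Q \Po (1 - 'X)) != 0.
  rewrite mulf_neq0 //; first by apply: contraNneq P0 => ->; rewrite horner0.
  apply: contraNneq Q0 => /(congr1 (fun q => q.[1])).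
  by rewrite horner_comp !hornerE subrr => ->.
case/poly_nonroot => n; rewrite hornerM horner_comp !hornerE mulf_eq0 negb_or.
case/andP=> /PA iA /QB iB; apply: lin_iso_trans iA (lin_iso_sym _).
suff <- : (fun a => B a + (1 - n%:R) *: (A a - B a)) =
  (fun a => A a + n%:R *: (B a - A a)) by [].
apply: functional_extensionality_dep => a.
by apply/matrixP => i j; rewrite !mxE; ring.
Qed.
End Orbits.

Lemma nat_min (P : nat -> Prop) : (exists n, P n) ->
  exists n, P n /\ forall m, P m -> (n <= m)%N.
Proof.
case=> n; elim/ltn_ind: n => n IH Pn.
have [[m [mn Pm]]|H] := classic (exists m, (m < n)%N /\ P m); first exact: IH Pm.
exists n; split => // m Pm; rewrite leqNgt; apply/negP => mn.
by apply: H; exists m.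
Qed.

Definition tits_weakly_positive t (G : biquiver t) :=
  forall d : 'I_t -> nat, (exists v, d v != 0%N) ->
    (\sum_(a < narr G) d (src G a) * d (tgt G a) < \sum_v d v ^ 2)%N.

(** * Indecomposables are bricks (Ringel) *)

Section Ringel.
Variables (C : numClosedFieldType) (t : nat) (G : biquiver t).
Hypothesis W : tits_weakly_positive G.
Implicit Types A U K : rep C G.

Definition brick A := rep_nonzero A /\
  forall F : fam A A, lin_morphism F -> exists c, forall v, F v = c%:M.

(** By rank-nullity for the coboundary, [q d = 1 - dim Ext^1 (A, A)]; weak positivity gives
    [q d >= 1], so the [Ext] vanishes and [q d = 1]. *)
Lemma brick_rigid A : brick A -> rigid A /\
  (\sum_v rdim A v ^ 2 = (\sum_(a < narr G) rdim A (src G a) * rdim A (tgt G a)).+1)%N.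
Proof.
case: A => d A [[v0 /= dv0] br] /=.
pose L := cobd_mx A A; pose one := vec (p := d) (q := d) (fun v => 1%:M : 'M[C]__).
have one0 : one != 0.
  apply/eqP => /(congr1 (fun r => unvec r v0)); rewrite vecK.
  move/matrixP=> /(_ (Ordinal (etrans (lt0n _) dv0)) (Ordinal (etrans (lt0n _) dv0))).
  by rewrite !mxE eqxx => /eqP; rewrite oner_eq0.
have rk : \rank (kermx L) = 1%N.
  apply/eqP; rewrite eqn_leq lt0n mxrank_eq0; apply/andP; split.
    apply: leq_trans (rank_leq_row one); apply: mxrankS; apply/row_subP => i.
    have /cobd_mx_eq0/br[c rc] : vec (unvec (row i (kermx L))) *m cobd_mx A A = 0.
      by rewrite unvecK; apply/sub_kermxP; rewrite row_sub.
    apply/sub_rVP; exists c; rewrite -[LHS]unvecK (eq_vec rc).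
    by apply/rowP => j; rewrite !mxE mulr_natr.
  apply: contraNneq one0 => K0.
  have : (one <= kermx L)%MS.
    apply/sub_kermxP; rewrite cobd_mxE (@eq_vec _ _ _ _ _ (fun a => 0)) => [|a].
      by apply/rowP => i; rewrite !mxE.
    by rewrite mul1mx mulmx1 subrr.
  by rewrite K0 submx0.
have := mxrank_ker L; have := rank_leq_col L; have := rank_leq_row L.
rewrite rk => r1 r2 r3; have c1 := card_entry_index d d.
have c2 := card_entry_index (fun a : 'I_(narr G) => d (tgt G a)) (fun a => d (src G a)).
rewrite /= in c1 c2; have := W (ex_intro _ v0 dv0).
have -> : (\sum_v d v ^ 2 = \sum_v d v * d v)%N by apply: eq_bigr => v _; rewrite mulnn.
have E : (\sum_(a < narr G) d (src G a) * d (tgt G a)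
        = \sum_(a < narr G) d (tgt G a) * d (src G a))%N.
  by apply: eq_bigr => a _; rewrite mulnC.
rewrite E => lt.
have aux (r n1 n2 s1 s2 : nat) : (r <= n1 -> r <= n2 -> 1 = n1 - r -> n1 = s1 ->
    n2 = s2 -> s2 < s1 -> s1 = s2.+1 /\ n2 <= r)%N by lia.
have [-> le] := aux _ _ _ _ _ r1 r2 r3 c1 c2 lt; split=> //.
by apply/rigidP; rewrite /row_full eqn_leq r2.
Qed.

(** An eigenvalue at one vertex is subtracted from a non-scalar endomorphism: the result is nonzero,
    yet singular at that vertex. *)
Lemma nonbrick_endo A : rep_nonzero A -> ~ brick A ->
  exists F : fam A A, [/\ lin_morphism F, (0 < frank F)%N & (frank F < fdim A)%N].
Proof.
move=> nzA nb; have [v0 dv0] := nzA.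
have [F [mF nF]] : exists F : fam A A, lin_morphism F /\ ~ exists c, forall v, F v = c%:M.
  apply: NNPP => H; apply: nb; split => // F mF; apply: NNPP => nF.
  by apply: H; exists F.
have [c] := eigenvalue_closed (F v0) (etrans (lt0n _) dv0) => ev.
exists (fun v => F v - c%:M); split.
- by move=> a; rewrite mulmxBr mulmxBl mF mul_mx_scalar mul_scalar_mx.
- rewrite lt0n; apply/eqP => /frank_eq0 H; apply: nF; exists c => v.
  by apply/eqP; rewrite -subr_eq0 H.
- rewrite /frank /fdim (bigD1 v0) //= [X in (_ < X)%N](bigD1 v0) //= -addSn leq_add //.
    rewrite ltn_neqAle rank_leq_row andbT; apply/negP => fr.
    move/eigenvalueP: ev => [x xF /negP]; apply.
    rewrite -(mulmx_free_eq0 x (B := F v0 - c%:M) fr).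
    by rewrite mulmxBr xF mul_mx_scalar subrr.
  by apply: leq_sum => v _; apply: rank_leq_row.
Qed.

(* With [K = ker J]: since [J] embeds [A / K] in [U], the obstruction in
   [Ext^1 (A / K, U)] to extending a morphism [K -> U] to [A] comes from
   [Ext^1 (U, U) = 0]. *)
Lemma rigid_extend K A U (i : fam K A) (p : fam K U) (r : fam A U) (J : fam A U) :
  lin_morphism i -> lin_morphism p -> lin_morphism J ->
  (forall v, r v *m i v = p v) ->
  (forall v k (H : 'M_(k, rdim A v)), H *m i v = 0 -> exists X, H = X *m J v) ->
  rigid U ->
  exists2 r' : fam A U, lin_morphism r' &
    forall v, exists Y, r' v = r v - Y *m J v.
Proof.
move=> mi mp mJ ri fac rU.
pose D a := r (tgt G a) *m rmap A a - rmap U a *m r (src G a).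
have Di a : D a *m i (src G a) = 0.
  by rewrite mulmxBl -!mulmxA mi ri mp mulmxA ri subrr.
have [xi xiE] := fin_all_exists (fun a => fac _ _ _ (Di a)).
have [h hE] := rU xi.
exists (fun v => r v - h v *m J v) => [a|v]; last by exists (h v).
have : D a = h (tgt G a) *m (J (tgt G a) *m rmap A a) - rmap U a *m (h (src G a) *m J (src G a)).
  by rewrite xiE hE mulmxBl -mJ !mulmxA.
move/eqP; rewrite /D subr_eq mulmxBr mulmxBl => /eqP ->.
by rewrite !mulmxA addrAC (addrAC (_ *m _)) subrr add0r addrC.
Qed.

(** [T] is a nonzero endomorphism of least total rank. If its square were nonzero, it would have the
    same rank as [T] at every vertex, and the Fitting projections would form a nontrivial idempotent
    endomorphism. *)
Lemma nonbrick_square_zero A : lin_indecomposable A -> ~ brick A ->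
  exists T : fam A A, [/\ lin_morphism T, (0 < frank T < fdim A)%N,
    forall v, T v *m T v = 0 &
    forall F : fam A A, lin_morphism F -> (0 < frank F)%N -> (frank T <= frank F)%N].
Proof.
move=> [nzA indA] nb; have [F [mF F0 FA]] := nonbrick_endo nzA nb.
pose P n := exists F : fam A A, [/\ lin_morphism F, (0 < frank F)%N & frank F = n].
have [_ [[T [mT T0 <-]] Tmin]] : exists n, P n /\ forall m, P m -> (n <= m)%N.
  by apply: nat_min; exists (frank F), F.
have {}Tmin (H : fam A A) : lin_morphism H -> (0 < frank H)%N -> (frank T <= frank H)%N.
  by move=> mH H0; apply: Tmin; exists H.
have TA : (frank T < fdim A)%N by apply: leq_ltn_trans (Tmin _ mF F0) FA.
exists T; split=> //; first by rewrite T0.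
apply: NNPP => TT.
have T20 : (0 < frank (fam_comp T T))%N.
  by rewrite lt0n; apply/eqP => /frank_eq0.
have rTT v : \rank (T v *m T v) = \rank (T v).
  apply: (leq_sum_eq (fun v => mxrankM_maxr (T v) (T v))).
  exact: Tmin (lin_morphism_comp mT mT) T20.
have [e] := fin_all_exists (fun v => rank_sqr_group (rTT v)).
case/fin_all_exists=> X /fin_all_exists[Y eE].
(* Because [e] is a left multiple of [T], [e A e = e A]; because it is a right multiple,
   [e A e = A e]. *)
have me : lin_morphism e.
  move=> a.
  have H1 : e (tgt G a) *m rmap A a *m e (src G a) = e (tgt G a) *m rmap A a.
    have [-> _ _ _ _] := eE (tgt G a); have [_ _ _ Te _] := eE (src G a).
    by rewrite -(mulmxA (Y _)) -mT -!mulmxA Te.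
  have H2 : e (tgt G a) *m rmap A a *m e (src G a) = rmap A a *m e (src G a).
    have [_ -> _ _ _] := eE (src G a); have [_ _ eT _ _] := eE (tgt G a).
    by rewrite !mulmxA -(mulmxA _ _ (T _)) mT mulmxA eT.
  by rewrite -H1 H2.
have [|e0|e1] := indA e me; first by move=> v; case: (eE v).
- move: T0; rewrite lt0n => /eqP; apply; rewrite /frank big1 // => v _.
  by have [_ _ <- _ _] := eE v; rewrite e0 mul0mx mxrank0.
- move: TA; rewrite ltnNge => /negP; apply; apply: leq_sum => v _.
  rewrite -{1}(mxrank1 C (rdim A v)) -(e1 v).
  by have [-> _ _ _ _] := eE v; apply: mxrankM_maxr.
Qed.

(** As [T] has square zero, it factors through [K = ker T]. [U] is a smallest summand of [K] onto
    which [T] has a nonzero component. Were [U] rigid, the projection [K -> U] would extend to [A]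
    and make [U] a proper summand of [A]. *)
Lemma ringel_step A : lin_indecomposable A -> ~ brick A ->
  exists U, [/\ lin_indecomposable U, (fdim U < fdim A)%N & ~ rigid U].
Proof.
move=> indA nb; have [T [mT /andP[T0 TA] TT Tmin]] := nonbrick_square_zero indA nb.
have [K [i [q [mi qi iq dK]]]] := kernel_exists mT.
have Ti v : T v *m i v = 0.
  have := congr1 (fun M => T v *m (i v *m M)) (qi v).
  by rewrite /= (mulmxA (i v)) iq mulmxA mul_kerproj mul0mx mulmx1.
pose T' : fam A K := fun v => q v *m T v.
have iT' v : i v *m T' v = T v by rewrite mulmxA iq kerproj_id.
have mT' : lin_morphism T'.
  move=> a; rewrite -[LHS]mul1mx -qi -mulmxA (mulmxA (i _)) -mi.
  by rewrite -(mulmxA (rmap A a)) iT' mT mulmxA.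
have T'0 : exists v, T' v != 0.
  apply: NNPP => H; move: T0; rewrite lt0n => /eqP; apply.
  rewrite /frank big1 // => v _; have [|/negP T'v] := boolP (T' v == 0).
    by move/eqP => T'v; rewrite -iT' T'v mulmx0 mxrank0.
  by case: H; exists v; apply/negP.
(* The summand is the image of an idempotent of [K] of least rank not killing [T']. *)
pose P n := exists e : fam K K, [/\ lin_morphism e, forall v, e v *m e v = e v,
  exists v, e v *m T' v != 0 & frank e = n].
have [_ [[e [me ee [v0 eT'] <-]] emin]] : exists n, P n /\ forall m, P m -> (n <= m)%N.
  apply: nat_min; exists (frank (fam1 K)), (fam1 K).
  split => // [a|v|]; rewrite /fam1 ?mul1mx ?mulmx1 //.
  by case: T'0 => v; exists v; rewrite mul1mx.
have {P}emin (f : fam K K) : lin_morphism f -> (forall v, f v *m f v = f v) ->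
    (exists v, f v *m T' v != 0) -> (frank e <= frank f)%N.
  by move=> mf ff f0; apply: emin; exists f.
have [U [j [p [mj mp pj jp dU]]]] := idempotent_split me ee.
have U0 : rdim U v0 != 0%N.
  by apply: contraNneq eT' => /eqP; rewrite dU mxrank_eq0 => /eqP ->; rewrite mul0mx.
(* By minimality of [e], an idempotent [f] of [U] whose component of [T'] is nonzero has full rank.
   This will apply to [f] or to [1 - f]. *)
have full_idem (f : fam U U) : lin_morphism f -> (forall v, f v *m f v = f v) ->
    (exists v, j v *m f v *m p v *m T' v != 0) -> forall v, f v = 1%:M.
  move=> mf ff f0 v; apply: idempotent_full => //.
  apply: (leq_sum_eq (fun v => rank_leq_row (f v))) => {v}.
  rewrite (eq_bigr (fun v => \rank (e v))) => [|v _]; last by rewrite dU.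
  apply: (@leq_trans (frank (fam_comp j (fam_comp f p)))).
    apply: emin; first by do 2! apply: lin_morphism_comp => //.
      move=> v; rewrite /fam_comp -!mulmxA (mulmxA (p v)) pj mul1mx.
      by rewrite (mulmxA (f v)) ff.
    by case: f0 => v; exists v; rewrite /fam_comp (mulmxA (j v)).
  apply: leq_sum => v _; rewrite /fam_comp.
  exact: leq_trans (mxrankM_maxr _ _) (mxrankM_maxl _ _).
have indU : lin_indecomposable U.
  split; first by exists v0.
  move=> f mf ff; have [H|H] := eqVneq (j v0 *m f v0 *m p v0 *m T' v0) 0; last first.
    by right; apply: full_idem => //; exists v0.
  left => v; suff /(_ v) /eqP : forall v, 1%:M - f v = 1%:M.
    by rewrite subr_eq -subr_eq0 opprD addrA subrr sub0r oppr_eq0 => /eqP.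
  apply: full_idem => [a|u|].
  - by rewrite mulmxBl mulmxBr mulmx1 mul1mx mf.
  - by rewrite mulmxBl !mulmxBr !mulmx1 !mul1mx ff subrr subr0.
  - by exists v0; rewrite mulmxBr mulmx1 !mulmxBl H jp subr0.
exists U; split=> //.
  apply: (@leq_ltn_trans (fdim K)).
    by apply: leq_sum => v _; rewrite dU rank_leq_row.
  have <- : (fdim K + frank T = fdim A)%N.
    rewrite -big_split; apply: eq_bigr => v _ /=.
    by rewrite dK mxrank_kerproj.
  by rewrite -addn1 leq_add2l.
move=> rU; pose J : fam A U := fun v => p v *m T' v.
have mJ : lin_morphism J by apply: lin_morphism_comp.
have J0 : (0 < frank (fam_comp i (fam_comp j J)))%N.
  rewrite lt0n; apply/eqP => /frank_eq0 /(_ v0) /(congr1 (mulmx (q v0))).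
  rewrite mulmx0 /fam_comp mulmxA qi mul1mx /J mulmxA jp => H.
  by rewrite H eqxx in eT'.
(* The nonzero endomorphism through [J] has rank at least that of [T], while the rows of [J v] lie
   in the row space of [T v]; hence the two row spaces agree. *)
have TJ v : exists Z, T v = Z *m J v.
  apply/submxP; have JT : (J v <= T v)%MS by rewrite /J /T' mulmxA submxMl.
  have rG : \rank (fam_comp i (fam_comp j J) v) = \rank (T v).
    apply: leq_sum_eq (Tmin _ _ J0) _.
      move=> u; rewrite /fam_comp /J /T' !mulmxA; exact: mxrankM_maxr.
    by do 2! apply: lin_morphism_comp => //.
  have := mxrank_leqif_sup JT; case=> _ <-.
  rewrite eqn_leq mxrankS //= -rG /fam_comp mulmxA.
  exact: mxrankM_maxr.
have [||r' mr' r'E] := @rigid_extend K A U i p (fun v => p v *m q v) J mi mp mJ _ _ rU.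
- by move=> v; rewrite -mulmxA qi mulmx1.
- move=> v k H Hi; have [Z TZ] := TJ v.
  exists (H *m pinvmx (T v) *m Z); rewrite -mulmxA -TZ; apply: kerproj_factor.
  by rewrite -iq mulmxA Hi mul0mx.
have r'i v : r' v *m i v = p v.
  have [Y ->] := r'E v.
  by rewrite mulmxBl /J /T' -!mulmxA Ti qi !mulmx0 mulmx1 subr0.
(* From [r' *m i *m j = p *m j = 1], [E] is idempotent. It is nonzero because [U] is, and not the
   identity because [T] kills the image of [i]. *)
pose E := fam_comp i (fam_comp j r').
have [||E0|E1] := (proj2 indA) E.
- by do 2! apply: lin_morphism_comp => //.
- move=> v; rewrite /E /fam_comp -!mulmxA (mulmxA (r' v)) r'i.
  by rewrite (mulmxA (p v)) pj mul1mx.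
- have := congr1 (fun M => r' v0 *m M *m i v0 *m j v0) (E0 v0).
  rewrite /E /fam_comp mulmx0 !mul0mx !mulmxA r'i pj mul1mx r'i pj.
  by move/eqP; rewrite -mxrank_eq0 mxrank1 (negPf U0).
- move: T0; rewrite lt0n => /eqP; apply; rewrite /frank big1 // => v _.
  by rewrite -[T v]mulmx1 -(E1 v) /E /fam_comp mulmxA Ti mul0mx mxrank0.
Qed.

(** Induction on the total dimension: a non-brick would yield a smaller indecomposable that is not
    rigid. *)
Lemma lin_indecomposable_rigid A : lin_indecomposable A -> rigid A /\
  (\sum_v rdim A v ^ 2 = (\sum_(a < narr G) rdim A (src G a) * rdim A (tgt G a)).+1)%N.
Proof.
have [n] := ubnP (fdim A); elim: n A => // n IH A /ltnSE An indA.
apply: brick_rigid; apply: NNPP => nb.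
have [U [indU UA nrU]] := ringel_step indA nb.
by have [] := IH U (leq_trans UA An) indU.
Qed.
End Ringel.

(** * Conjugation of spaces and finiteness of the set of roots *)

Section ConjugateIf.
Variable C : numClosedFieldType.

Definition conj_if (b : bool) m n (M : 'M[C]_(m, n)) : 'M[C]_(m, n) :=
  if b then conj_mx M else M.

Lemma conj_mxM m n p (M : 'M[C]_(m, n)) (N : 'M_(n, p)) :
  conj_mx (M *m N) = conj_mx M *m conj_mx N.
Proof. exact: map_mxM. Qed.

Lemma conj_mxK m n (M : 'M[C]_(m, n)) : conj_mx (conj_mx M) = M.
Proof. by apply/matrixP => i j; rewrite !mxE conjCK. Qed.

Lemma conj_mx1 n : conj_mx (1%:M : 'M[C]_n) = 1%:M.
Proof. exact: map_mx1. Qed.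

Lemma conj_ifM b m n p (M : 'M[C]_(m, n)) (N : 'M_(n, p)) :
  conj_if b (M *m N) = conj_if b M *m conj_if b N.
Proof. by case: b => //=; apply: conj_mxM. Qed.

Lemma conj_ifK b m n (M : 'M[C]_(m, n)) : conj_if b (conj_if b M) = M.
Proof. by case: b => //=; apply: conj_mxK. Qed.

Lemma conj_if1 b n : conj_if b (1%:M : 'M[C]_n) = 1%:M.
Proof. by case: b => //=; apply: conj_mx1. Qed.

Lemma conj_if_block b m1 m2 n1 n2 (M : 'M[C]_(m1, n1)) (N : 'M_(m2, n2)) :
  conj_if b (block_mx M 0 0 N) = block_mx (conj_if b M) 0 0 (conj_if b N).
Proof. by case: b => //=; rewrite /conj_mx map_block_mx !map_mx0. Qed.
End ConjugateIf.

Section Toggle.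
Variables (C : numClosedFieldType) (t : nat) (G : biquiver t).
Variable s : 'I_t -> bool.
(** An arrow is dashed exactly when [s] takes different values at its ends. *)
Hypothesis s_full : forall a, full G a (+) s (src G a) (+) s (tgt G a).
Implicit Types A B : rep C G.

(* The spaces at the vertices of [s] are replaced by their complex conjugates. *)
Definition toggle A : rep C G :=
  @Rep C t G (rdim A) (fun a => conj_if (s (tgt G a)) (rmap A a)).

Definition conj_fam A B (F : fam A B) : fam A B := fun v => conj_if (s v) (F v).

Lemma toggle_morph A B (F : fam A B) :
  lin_morphism (conj_fam F : fam (toggle A) (toggle B)) <-> is_morphism F.
Proof.
split=> H a; have := H a; have := s_full a; rewrite /conj_fam /= => sa.
  move/(congr1 (fun M => conj_if (s (tgt G a)) M)); rewrite /= !conj_ifM !conj_ifK => <-.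
  congr (_ *m _); move: sa.
  by case: (full G a) (s (src G a)) (s (tgt G a)) => [] [] [] //=; rewrite conj_mxK.
move/(congr1 (fun M => conj_if (s (tgt G a)) M)); rewrite /= !conj_ifM => <-.
congr (_ *m _); move: sa.
by case: (full G a) (s (src G a)) (s (tgt G a)) => [] [] [] //=; rewrite conj_mxK.
Qed.

Lemma toggle_iso A B : lin_iso (toggle A) (toggle B) -> rep_iso A B.
Proof.
case=> F [mF Finv]; exists (conj_fam F); split=> [|v].
  apply/toggle_morph; move=> a; have := mF a.
  by rewrite /conj_fam !conj_ifK.
have [H [HF FH]] := Finv v; exists (conj_if (s v) H).
by rewrite /conj_fam -!conj_ifM HF FH !conj_if1.
Qed.

Lemma toggle_indecomposable A : indecomposable A -> lin_indecomposable (toggle A).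
Proof.
move=> [nzA indA]; split=> // e me ee; apply: NNPP => nt; apply: indA.
pose e' v := 1%:M - e v.
have me' : lin_morphism (e' : fam (toggle A) (toggle A)).
  by move=> a; rewrite /e' mulmxBl mulmxBr mulmx1 mul1mx me.
have ee' v : e' v *m e' v = e' v.
  by rewrite /e' mulmxBl !mulmxBr !mulmx1 !mul1mx ee subrr subr0.
have [U [i [p [mi mp pi ip dU]]]] := idempotent_split me ee.
have [U' [i' [p' [mi' mp' pi' ip' dU']]]] := idempotent_split me' ee'.
have nz (V : rep C G) (g : fam (toggle A) (toggle A)) : (forall v, rdim V v = \rank (g v)) ->
    ~ rep_nonzero V -> forall v, g v = 0.
  move=> dV nzV v; apply/eqP; rewrite -mxrank_eq0 -dV; apply/negPn/negP => V0.
  by apply: nzV; exists v.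
(* Conjugation is involutive, so toggling the summands of [toggle A] gives summands of [A]. *)
exists (toggle U), (toggle U'); split; last split.
- apply: NNPP => H; apply: nt; left; exact: nz dU H.
- apply: NNPP => H; apply: nt; right => v.
  by apply/esym/eqP; rewrite -subr_eq0; apply/eqP; apply: (nz U' e').
have pi'0 v : p v *m i' v = 0.
  have -> : p v *m i' v = p v *m (i v *m p v *m (i' v *m p' v)) *m i' v.
    by rewrite !mulmxA pi mul1mx -!mulmxA pi' mulmx1.
  by rewrite ip ip' /e' mulmxBr mulmx1 ee subrr mulmx0 mul0mx.
have p'i0 v : p' v *m i v = 0.
  have -> : p' v *m i v = p' v *m (i' v *m p' v *m (i v *m p v)) *m i v.
    by rewrite !mulmxA pi' mul1mx -!mulmxA pi mulmx1.
  by rewrite ip ip' /e' mulmxBl mul1mx ee subrr mulmx0 mul0mx.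
apply: toggle_iso.
exists (fun v => col_mx (p v) (p' v)); split=> [a /=|v].
  rewrite conj_if_block !conj_ifK -[conj_if _ _]/(rmap (toggle A) a).
  apply: etrans (mul_block_col _ _ _ _ _ _) _.
  apply: etrans _ (esym (mul_col_mx _ _ _)).
  by rewrite !mul0mx addr0 add0r mp mp'.
exists (row_mx (i v) (i' v)); split.
  by apply: etrans (mul_row_col _ _ _ _) _; rewrite ip ip' /e' addrC subrK.
apply: etrans (mul_col_row _ _ _ _) _.
by rewrite pi pi'0 p'i0 pi' -scalar_mx_block.
Qed.
End Toggle.

(** Indecomposables occur only in the dimension vectors bounded by [b], and rigidity allows at most
    one class for each of them. *)
Lemma toggle_rep_finite (C : numClosedFieldType) t (G : biquiver t) (s : 'I_t -> bool) b :
  (forall a, full G a (+) s (src G a) (+) s (tgt G a)) ->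
  tits_weakly_positive G ->
  (forall d : 'I_t -> nat,
    (\sum_v d v ^ 2 = (\sum_(a < narr G) d (src G a) * d (tgt G a)).+1)%N ->
    forall v, (d v <= b)%N) ->
  rep_finite C G.
Proof.
move=> sG W bd; pose D := {ffun 'I_t -> 'I_b.+1}.
(* An indecomposable of dimension [d] if there is one, and the zero representation as a default. *)
have H (d : D) : exists R : rep C G,
    forall A : rep C G, indecomposable A -> rdim A = (fun v => d v : nat) ->
      indecomposable R /\ rdim R = (fun v => d v : nat).
  have [[A [iA dA]]|H] := classic (exists A : rep C G,
    indecomposable A /\ rdim A = (fun v => d v : nat)).
    by exists A.
  exists (@Rep C t G (fun=> 0%N) (fun=> 0)) => A iA dA.
  by case: H; exists A.
have [R RE] := fin_all_exists H.
exists #|{: D}|, (fun i => R (enum_val i)) => A iA.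
have [rA qA] := lin_indecomposable_rigid W (toggle_indecomposable sG iA).
pose d : D := [ffun v => inord (rdim A v)].
have dA : rdim A = (fun v => d v : nat).
  by apply: functional_extensionality => v; rewrite ffunE inordK // ltnS (bd _ qA).
exists (enum_rank d); rewrite enum_rankK; have [iR dR] := RE d A iA dA.
have [rR _] := lin_indecomposable_rigid W (toggle_indecomposable sG iR).
apply: (toggle_iso sG); move: (R d) iR dR rR {RE}; rewrite -dA => B _ dR rR.
(* Eliminating the equality of the dimension functions puts both families of maps over the same
   [d]. *)
case: A B {iA qA dA d} rA dR rR => dA A [dB B] rA /= dAB; case: _ / dAB in A rA *.
exact: rigid_iso.
Qed.

(** * Boundedness of the roots of a positive definite form *)

Section FiniteRoots.
Variables (C : numClosedFieldType) (t : nat) (G : biquiver t).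
Hypothesis pd : tits_pos_def C G.

Lemma pos_def_weakly_positive : tits_weakly_positive G.
Proof.
move=> d [v dv].
have := pd (x := fun v => (d v)%:R) (fun i => realn _ _); rewrite /tits_form.
have -> : \sum_(i < t) (d i)%:R ^+ 2 = (\sum_v d v ^ 2)%:R :> C.
  by rewrite natr_sum; apply: eq_bigr => i _; rewrite natrX.
have -> : \sum_(a < narr G) (d (src G a))%:R * (d (tgt G a))%:R =
    (\sum_(a < narr G) d (src G a) * d (tgt G a))%:R :> C.
  by rewrite natr_sum; apply: eq_bigr => i _; rewrite natrM.
by rewrite subr_gt0 ltr_nat; apply; exists v; rewrite pnatr_eq0.
Qed.

Let q (x : 'rV[rat]_t) :=
  \sum_(i < t) x 0 i ^+ 2 - \sum_(a < narr G) x 0 (src G a) * x 0 (tgt G a).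

Let q_pos x : x != 0 -> 0 < q x.
Proof.
move=> x0; rewrite -(ltr0q C).
have -> : ratr (q x) = tits_form G (fun v => ratr (x 0 v) : C).
  rewrite rmorphB !rmorph_sum /=; congr (_ - _); apply: eq_bigr => i _.
    by rewrite rmorphXn.
  by rewrite rmorphM.
apply: pd => [i|]; first exact: rpred_rat.
apply: NNPP => H; move/eqP: x0; apply; apply/rowP => i; rewrite mxE.
apply/eqP/negPn/negP => xi; apply: H; exists i; by rewrite fmorph_eq0.
Qed.

Let q_ge0 x : 0 <= q x.
Proof.
have [->|/q_pos/ltW //] := eqVneq x 0.
rewrite /q !big1 ?subrr // => i _; rewrite !mxE ?mul0r ?expr0n //.
Qed.

(** The gradient of [q]; [pair] below is the polar form [q (x + y) - q x - q y]. *)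
Let grad (x : 'rV[rat]_t) : 'rV[rat]_t := \row_j (2 * x 0 j -
  \sum_(a < narr G) (x 0 (src G a) * (tgt G a == j)%:R + x 0 (tgt G a) * (src G a == j)%:R)).

Let grad_linear : linear grad.
Proof.
move=> c x y; apply/rowP => j; rewrite !mxE mulrBr mulr_sumr addrACA -opprD -big_split /=.
congr (_ - _); first by ring.
by apply: eq_bigr => a _; rewrite !mxE; ring.
Qed.

HB.instance Definition _ := GRing.isLinear.Build rat _ _ _ grad grad_linear.

Let pair (x y : 'rV[rat]_t) := \sum_j grad x 0 j * y 0 j.

Let pairE x y : pair x y = 2 * (\sum_j x 0 j * y 0 j) -
  \sum_(a < narr G) (x 0 (src G a) * y 0 (tgt G a) + x 0 (tgt G a) * y 0 (src G a)).
Proof.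
rewrite /pair (eq_bigr (fun j => 2 * (x 0 j * y 0 j) - \sum_(a < narr G)
    ((x 0 (src G a) * (tgt G a == j)%:R + x 0 (tgt G a) * (src G a == j)%:R) * y 0 j))).
  rewrite sumrB -mulr_sumr exchange_big /=; congr (_ - _); apply: eq_bigr => a _.
  have pick (z : rat) k : \sum_j z * (k == j)%:R * y 0 j = z * y 0 k.
    rewrite (bigD1 k) //= eqxx mulr1 big1 ?addr0 // => j.
    by rewrite eq_sym => /negPf ->; rewrite mulr0 mul0r.
  by rewrite -!pick -big_split /=; apply: eq_bigr => j _; rewrite mulrDl.
by move=> j _; rewrite mxE mulrBl -mulr_suml mulrA.
Qed.

Let qD c x e y : q (c *: x + e *: y) = c ^+ 2 * q x + c * e * pair y x + e ^+ 2 * q y.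
Proof.
rewrite pairE /q.
have -> : \sum_(i < t) (c *: x + e *: y) 0 i ^+ 2 = c ^+ 2 * (\sum_i x 0 i ^+ 2) +
    2 * c * e * (\sum_i y 0 i * x 0 i) + e ^+ 2 * (\sum_i y 0 i ^+ 2).
  rewrite !mulr_sumr -!big_split /=; apply: eq_bigr => i _; rewrite !mxE; ring.
have -> : \sum_(a < narr G) (c *: x + e *: y) 0 (src G a) * (c *: x + e *: y) 0 (tgt G a)
   = c ^+ 2 * (\sum_(a < narr G) x 0 (src G a) * x 0 (tgt G a)) + c * e *
  (\sum_(a < narr G) (y 0 (src G a) * x 0 (tgt G a) + y 0 (tgt G a) * x 0 (src G a)))
  + e ^+ 2 * (\sum_(a < narr G) y 0 (src G a) * y 0 (tgt G a)).
  rewrite !mulr_sumr -!big_split /=; apply: eq_bigr => i _; rewrite !mxE; ring.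
ring.
Qed.

Let pair_diag x : pair x x = 2 * q x.
Proof.
rewrite pairE /q mulrBr; congr (_ - _); rewrite mulr_sumr; apply: eq_bigr => a _.
ring.
Qed.

(** Each coordinate is [pair (w v)] for a suitable [w v], since the polar form is nondegenerate. The
    Cauchy-Schwarz inequality then bounds it on the vectors with [q x = 1]. *)
Lemma pos_def_roots_bounded : exists b : nat, forall d : 'I_t -> nat,
  (\sum_v d v ^ 2 = (\sum_(a < narr G) d (src G a) * d (tgt G a)).+1)%N ->
  forall v, (d v <= b)%N.
Proof.
have free : row_free (lin1_mx grad).
  rewrite -kermx_eq0; apply/eqP/row_matrixP => i; rewrite row0.
  set x := row i _; apply/eqP/negPn/negP => /q_pos.
  have : x *m lin1_mx grad = 0 by apply/sub_kermxP; rewrite row_sub.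
  rewrite mul_rV_lin1 /= => gx; have := pair_diag x.
  rewrite /pair gx big1 => [/esym/eqP|j _]; last by rewrite mxE mul0r.
  by rewrite mulf_eq0 /= => /eqP ->; rewrite ltxx.
have [w wE] : exists w : 'I_t -> 'rV[rat]_t, forall i, grad (w i) = delta_mx 0 i.
  have/row_freeP[R RE] := free.
  have : row_full (lin1_mx grad) by rewrite row_full_unit -row_free_unit.
  case/row_fullP=> B BE; exists (fun i => row i B) => i.
  by rewrite -[LHS](mul_rV_lin1 grad) -row_mul BE row1.
exists (Num.bound (\sum_i 4 * q (w i))) => d dq v.
pose x : 'rV[rat]_t := \row_i (d i)%:R.
have qx : q x = 1.
  rewrite /q; have -> : \sum_(i < t) x 0 i ^+ 2 = (\sum_v d v ^ 2)%:R.
    by rewrite natr_sum; apply: eq_bigr => i _; rewrite mxE natrX.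
  have -> : \sum_(a < narr G) x 0 (src G a) * x 0 (tgt G a) =
      (\sum_(a < narr G) d (src G a) * d (tgt G a))%:R.
    by rewrite natr_sum; apply: eq_bigr => i _; rewrite !mxE natrM.
  by rewrite dq -natr1 addrC addKr.
have wx : pair (w v) x = (d v)%:R.
  rewrite /pair wE (bigD1 v) //= !mxE !eqxx mul1r big1 ?addr0 // => j /negPf jv.
  by rewrite !mxE jv mul0r.
have w0 : w v != 0.
  apply/eqP => w0; have := wE v; rewrite w0 => /rowP/(_ v); rewrite !mxE !eqxx mulr0 big1.
    by move/eqP; rewrite subr0 eq_sym oner_eq0.
  by move=> a _; rewrite !mxE !mul0r addr0.
(* Cauchy-Schwarz: [q] at this vector equals [q (w v) * (4 * q (w v) - (d v)%:R ^+ 2)]. *)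
have := q_ge0 (2 * q (w v) *: x + (- (d v)%:R) *: w v).
rewrite qD wx qx => H.
have qw := q_pos w0.
have dv : (d v)%:R ^+ 2 <= 4 * q (w v).
  rewrite -(ler_pM2l qw); move: H; lra.
rewrite -(ler_nat rat); apply/ltW.
have S0 : 0 <= \sum_i 4 * q (w i) by apply: sumr_ge0 => i _; rewrite mulr_ge0.
apply: le_lt_trans (archi_boundP S0).
apply: (@le_trans _ _ ((d v)%:R ^+ 2)).
  by rewrite -natrX ler_nat; case: (d v) => // n; rewrite -mulnn leq_pmulr.
apply: le_trans dv _; rewrite [leRHS](bigD1 v) //= lerDl.
by apply: sumr_ge0 => i _; rewrite mulr_ge0.
Qed.
End FiniteRoots.

(** * Weakly positive graphs are Dynkin diagrams *)

Definition inj_below (T : Type) n (tau : nat -> T) :=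
  forall i j, (i < n)%N -> (j < n)%N -> tau i = tau j -> i = j.

Lemma sum_square_triangle (V : nmodType) n (F : nat -> nat -> V) :
  \sum_(i < n) \sum_(j < n) F i j =
  \sum_(i < n) (F i i + \sum_(j < i) (F i j + F j i)).
Proof.
elim: n => [|n IH]; first by rewrite !big_ord0.
rewrite big_ord_recr [RHS]big_ord_recr -IH /=.
rewrite (eq_bigr (fun i : 'I_n => \sum_(j < n) F i j + F i n)) => [|i _]; last first.
  by rewrite big_ord_recr.
rewrite big_split /= [\sum_(j < n.+1) _]big_ord_recr /= big_split /= -addrA.
by congr (_ + _); rewrite [RHS]addrC addrA [in RHS](addrC (\sum_(i < n) F n i)).
Qed.

Section Sums.
Variables (t : nat) (G : biquiver t).
Local Notation N := (n_arrows_between G).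

Lemma n_arrows_sym u v : N u v = N v u.
Proof. by apply: eq_card => a; rewrite !inE orbC. Qed.

Variables (R : comPzRingType) (n : nat) (tau : nat -> 'I_t).
Hypothesis tau_inj : inj_below n tau.

(** For injective [tau], this extends by zero a vector on the vertices [tau 0, ..., tau n.-1]. *)
Definition spread (c : nat -> R) (v : 'I_t) : R :=
  \sum_(i < n) c i * (tau i == v)%:R.

Variable c : nat -> R.

Lemma spread_at i : (i < n)%N -> spread c (tau i) = c i.
Proof.
move=> lt; rewrite /spread (bigD1 (Ordinal lt)) //= eqxx mulr1 big1 ?addr0 // => j ji.
case: eqP; last by rewrite mulr0.
by move/(tau_inj (ltn_ord j) lt) => E; case/eqP: ji; apply: val_inj.
Qed.

Lemma sum_spread_sqr : \sum_v spread c v ^+ 2 = \sum_(i < n) c i ^+ 2.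
Proof.
transitivity (\sum_v \sum_(i < n) spread c v * (c i * (tau i == v)%:R)).
  by apply: eq_bigr => v _; rewrite -mulr_sumr expr2.
rewrite exchange_big /=; apply: eq_bigr => i _.
rewrite (bigD1 (tau i)) //= eqxx mulr1 spread_at // -expr2 big1 ?addr0 // => v.
by rewrite eq_sym => /negPf ->; rewrite !mulr0.
Qed.

(** Arrows are grouped by unordered pairs of ends, whence [j <= i]; the terms [j = i] account for
    loops. *)
Lemma sum_spread_arrows :
  \sum_(a < narr G) spread c (src G a) * spread c (tgt G a) =
  \sum_(i < n) \sum_(j < i.+1) c i * c j * (N (tau i) (tau j))%:R.
Proof.
pose M i j : R := \sum_(a < narr G) (tau i == src G a)%:R * (tau j == tgt G a)%:R.
transitivity (\sum_(i < n) \sum_(j < n) c i * c j * M i j).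
  transitivity (\sum_(a < narr G) \sum_(i < n) \sum_(j < n)
      c i * c j * ((tau i == src G a)%:R * (tau j == tgt G a)%:R)).
    apply: eq_bigr => a _; rewrite big_distrlr; apply: eq_bigr => i _.
    by apply: eq_bigr => j _ /=; rewrite mulrACA.
  rewrite exchange_big; apply: eq_bigr => i _; rewrite exchange_big.
  by apply: eq_bigr => j _; rewrite /M mulr_sumr.
rewrite (sum_square_triangle n (fun i j => c i * c j * M i j)).
apply: eq_bigr => i _; rewrite big_ord_recr /= addrC; congr (_ + _).
  apply: eq_bigr => j _; rewrite (mulrC (c j)) -mulrDr; congr (_ * _).
  rewrite /M /n_arrows_between -big_split /= -sum1_card natr_sum [RHS]big_mkcond /=.
  apply: eq_bigr => a _.
  rewrite inE; have ij : tau i != tau j.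
    apply/eqP => /tau_inj E; have /eqP := E (ltn_ord i) (ltn_trans (ltn_ord j) (ltn_ord i)).
    by rewrite gtn_eqF.
  rewrite !(eq_sym (tau _)) -!natrM -natrD.
  have [->|_] := eqVneq (src G a) (tau i); have [->|_] := eqVneq (tgt G a) (tau j);
    rewrite ?eqxx ?andbF ?(negPf ij) /= ?[tau j == tau i]eq_sym ?(negPf ij) //=.
    by rewrite andbF muln0.
  by rewrite mul0n add0n mulnb; case: andb.
congr (_ * _); rewrite /M /n_arrows_between -sum1_card natr_sum [RHS]big_mkcond /=.
apply: eq_bigr => a _; rewrite inE !(eq_sym (tau _)) orbb -natrM mulnb.
by case: andb.
Qed.

End Sums.

Section Labellings.
Variables (t : nat) (G : biquiver t).
Local Notation N := (n_arrows_between G).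

Definition labelled (E : nat -> nat -> bool) n (tau : nat -> 'I_t) :=
  inj_below n tau /\
  forall i j, (i < n)%N -> (j < n)%N -> N (tau i) (tau j) = E i j.

(** The numbering makes [p i] the only neighbour of [i > 0] with a smaller number, so the edge sum
    has one term per non-root vertex. *)
Definition tree_parent (E : nat -> nat -> bool) n (p : nat -> nat) :=
  (forall i, (0 < i < n)%N -> (p i < i)%N) /\
  forall i j, (j <= i)%N -> (i < n)%N -> E i j = (0 < i)%N && (j == p i).

Lemma tree_sum_arrows (R : comPzRingType) E n p tau (c : nat -> R) :
  labelled E n tau -> tree_parent E n p ->
  \sum_(a < narr G) spread n tau c (src G a) * spread n tau c (tgt G a) =
  \sum_(i < n) (if (0 < i)%N then c i * c (p i) else 0).
Proof.
move=> [inj lab] [pi pE]; rewrite sum_spread_arrows //; apply: eq_bigr => i _.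
have NE (j : 'I_i.+1) : N (tau i) (tau j) = (0 < i)%N && (j == p i :> nat).
  have ji : (j <= i)%N by rewrite -ltnS ltn_ord.
  have jn : (j < n)%N by apply: leq_trans (ltn_ord j) (ltn_ord i).
  by rewrite (lab _ _ (ltn_ord i) jn) (pE _ _ ji (ltn_ord i)).
under eq_bigr => j _ do rewrite NE.
case: (posnP i) => [->|i0] /=; first by rewrite big1 // => j _; rewrite mulr0.
have pii : (p i < i.+1)%N by rewrite ltnS ltnW // pi // i0 /=.
rewrite (bigD1 (Ordinal pii)) //= eqxx mulr1 big1 ?addr0 // => j.
by rewrite -val_eqE /= => /negPf ->; rewrite mulr0.
Qed.

Hypothesis W : tits_weakly_positive G.

Lemma weakly_positive_spread n tau (c : nat -> nat) : inj_below n tau ->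
  (exists2 i, (i < n)%N & c i != 0%N) ->
  (\sum_(i < n) \sum_(j < i.+1) c i * c j * N (tau i) (tau j) < \sum_(i < n) c i ^ 2)%N.
Proof.
move=> inj [i lt ci]; pose d v := (\sum_(i < n) c i * (tau i == v))%N.
have dE v : (d v)%:R = spread n tau (fun i => (c i)%:R : int) v.
  by rewrite natr_sum; apply: eq_bigr => j _; rewrite natrM.
have : exists v, d v != 0%N.
  exists (tau i); rewrite -(eqr_nat int) dE spread_at //.
  by rewrite eqr_nat.
move/W; rewrite -!(ltr_nat int) !natr_sum.
have -> : \sum_(v < t) (d v ^ 2)%:R = \sum_(i < n) (c i ^ 2)%:R :> int.
  transitivity (\sum_v spread n tau (fun i => (c i)%:R : int) v ^+ 2).
    by apply: eq_bigr => v _; rewrite natrX dE.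
  by rewrite sum_spread_sqr //; apply: eq_bigr => j _; rewrite natrX.
have -> // : \sum_(a < narr G) (d (src G a) * d (tgt G a))%:R =
  \sum_(i < n) (\sum_(j < i.+1) c i * c j * N (tau i) (tau j))%:R :> int.
transitivity (\sum_(a < narr G) spread n tau (fun i => (c i)%:R : int) (src G a) *
    spread n tau (fun i => (c i)%:R : int) (tgt G a)).
  by apply: eq_bigr => v _; rewrite natrM !dE.
rewrite sum_spread_arrows //; apply: eq_bigr => j _.
by rewrite natr_sum; apply: eq_bigr => k _; rewrite !natrM.
Qed.

Lemma weakly_positive_tree E n p tau (c : nat -> nat) :
  labelled E n tau -> tree_parent E n p ->
  (exists2 i, (i < n)%N & c i != 0%N) ->
  (\sum_(i < n) (if (0 < i)%N then c i * c (p i) else 0) < \sum_(i < n) c i ^ 2)%N.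
Proof.
move=> [inj lab] pE c0; have := weakly_positive_spread inj c0.
rewrite -!(ltr_nat int) [X in (X < _ -> _)%R]natr_sum [X in (_ -> X < _)%R]natr_sum.
have := tree_sum_arrows (fun i => (c i)%:R : int) (conj inj lab) pE.
rewrite sum_spread_arrows // => E1; under eq_bigr => i _.
  rewrite natr_sum; under eq_bigr => j _ do rewrite !natrM.
  over.
rewrite E1; congr (_ < _)%R; apply: eq_bigr => i _.
by case: ifP => //; rewrite natrM.
Qed.

End Labellings.

Local Open Scope nat_scope.

Lemma path_edgeE m i j :
  path_edge m i j = ((i.+1 == j) || (j.+1 == i)) && ((i < m) && (j < m)).
Proof. by rewrite /path_edge gtn_max. Qed.

Ltac case_ifs := repeat match goal with
  | |- context [if ?b then _ else _] => case: (boolP b) => ? end.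

Ltac decide_atom a := first [ have -> : a = true by lia | have -> : a = false by lia
  | case: (boolP a) => ? ].

(* Much faster than a plain [lia] on equalities between Boolean combinations
   of comparisons. *)
Ltac decide_atoms := case_ifs; repeat (match goal with
  | |- context [@eq_op ?T ?a ?b] => decide_atom (@eq_op T a b)
  | |- context [leq ?a ?b] => decide_atom (leq a b)
  end; rewrite /= ?orbT ?orbF ?andbF ?andbT); by [].

(* A path [0 - ... - (n - 2)] with the vertex [n - 1] attached to [w]. *)
Definition comb_edge n w i j := path_edge n.-1 i j || extra_edge w n.-1 i j.
Definition comb_parent n w i := if i == n.-1 then w else i.-1.

(** The three cases are [A_n], [D_n] and [E_n]. *)
Definition comb_dynkin n w :=
  [|| (2 <= n) && (w == n - 2), (4 <= n) && (w == n - 3)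
    | (w == 2) && (6 <= n <= 8)].

Lemma comb_tree n w : 1 < n -> w < n.-1 -> tree_parent (comb_edge n w) n (comb_parent n w).
Proof.
move=> n1 wn; split=> [i|i j ji lt]; rewrite /comb_parent /comb_edge ?path_edgeE /extra_edge.
  by case: ifP; lia.
by case: ifP; lia.
Qed.

(** What a comb becomes when a new vertex [n] is attached to [u]. *)
Definition double_comb_edge n w u i j := comb_edge n w i j || extra_edge u n i j.
Definition double_comb_parent n w u i := if i == n then u else comb_parent n w i.

Lemma double_comb_tree n w u : 1 < n -> w < n.-1 -> u < n ->
  tree_parent (double_comb_edge n w u) n.+1 (double_comb_parent n w u).
Proof.
move=> n1 wn un; have [p1 p2] := comb_tree n1 wn.
split=> [i|i j ji lt]; rewrite /double_comb_parent; case: ifP => [/eqP ->|/eqP ni] //.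
- by move=> i0; apply: p1; lia.
- by rewrite /double_comb_edge /comb_edge ?path_edgeE /extra_edge; lia.
- rewrite -p2 //; last by lia.
  by rewrite /double_comb_edge /extra_edge; case: comb_edge => //=; lia.
Qed.

(** * Excluding the extended Dynkin diagrams *)

Section Grow.
Variables (t : nat) (G : biquiver t).
Local Notation N := (n_arrows_between G).
Hypothesis W : tits_weakly_positive G.

Lemma relabel E E' n m tau rho : labelled G E n tau ->
  (forall i, i < m -> rho i < n) ->
  (forall i j, i < m -> j < m -> rho i = rho j -> i = j) ->
  (forall i j, i < m -> j < m -> E (rho i) (rho j) = E' i j) ->
  labelled G E' m (tau \o rho).
Proof.
move=> [inj lab] rn rinj rE; split=> i j im jm /=.
  by move/inj => H; apply: rinj => //; apply: H; apply: rn.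
by rewrite lab ?rn // rE.
Qed.

(** Three vertices of the path on each side of [w], together with [w] and the pendant vertex, form
    the extended [E_7]; the listed weights are its null root. *)
Lemma no_E7_tilde n w tau : w < n.-1 -> 2 < w -> 4 < n - w ->
  ~ labelled G (comb_edge n w) n tau.
Proof.
move=> wn w3 nw lab; pose rho i := if i < 7 then i + w - 3 else n.-1.
have /(weakly_positive_tree W) H : labelled G (comb_edge 8 3) 8 (tau \o rho).
  apply: relabel lab _ _ _; rewrite /rho.
  - by move=> i i8; case: ifP; lia.
  - by move=> i j i8 j8; do 2! case: ifP; lia.
  - move=> i j i8 j8; rewrite /comb_edge ?path_edgeE /extra_edge.
    by decide_atoms.
have := H _ (nth 0 [:: 1; 2; 3; 4; 3; 2; 1; 2]) (@comb_tree 8 3 isT isT).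
rewrite !big_ord_recr !big_ord0 /= => H'.
by have := H' (ex_intro2 _ _ 0 isT isT).
Qed.

(** The first eight vertices of the path and the pendant vertex form the extended [E_8], tested at
    its null root. *)
Lemma no_E8_tilde n tau : 8 < n -> ~ labelled G (comb_edge n 2) n tau.
Proof.
move=> n8 lab; pose rho i := if i < 8 then i else n.-1.
have /(weakly_positive_tree W) H : labelled G (comb_edge 9 2) 9 (tau \o rho).
  apply: relabel lab _ _ _; rewrite /rho.
  - by move=> i i8; case: ifP; lia.
  - by move=> i j i8 j8; do 2! case: ifP; lia.
  - move=> i j i8 j8; rewrite /comb_edge ?path_edgeE /extra_edge.
    by decide_atoms.
have := H _ (nth 0 [:: 2; 4; 6; 5; 4; 3; 2; 1; 3]) (@comb_tree 9 2 isT isT).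
rewrite !big_ord_recr !big_ord0 /= => H'.
by have := H' (ex_intro2 _ _ 0 isT isT).
Qed.

(** Lengthening the pendant arm gives three arms of length 2, the extended [E_6], tested at its null
    root. *)
Lemma no_E6_tilde n tau : 5 < n -> ~ labelled G (double_comb_edge n 2 n.-1) n.+1 tau.
Proof.
move=> n5 lab; pose rho i := if i < 5 then i else n + i - 6.
have /(weakly_positive_tree W) H : labelled G (double_comb_edge 6 2 5) 7 (tau \o rho).
  apply: relabel lab _ _ _; rewrite /rho.
  - by move=> i i8; case: ifP; lia.
  - by move=> i j i8 j8; do 2! case: ifP; lia.
  - move=> i j i8 j8; rewrite /double_comb_edge /comb_edge ?path_edgeE /extra_edge.
    by decide_atoms.
have := H _ (nth 0 [:: 1; 2; 3; 2; 1; 2; 1]) (@double_comb_tree 6 2 5 isT isT isT).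
rewrite !big_ord_recr !big_ord0 /= => H'.
by have := H' (ex_intro2 _ _ 0 isT isT).
Qed.

Lemma no_D_tilde n w u tau : 0 < w < n - 2 -> 0 < u < n - 2 ->
  ~ labelled G (double_comb_edge n w u) n.+1 tau.
Proof.
move=> wn un lab; pose lo := minn w u; pose hi := maxn w u.
(* Null root of the extended [D]: 2 from [lo] to [hi], 1 at the four end vertices, 0 outside. For
   [lo = hi] it is that of the extended [D_4]. *)
pose c i := if n.-1 <= i then 1 else if (i.+1 < lo) || (hi.+1 < i) then 0
  else if (i.+1 == lo) || (i == hi.+1) then 1 else 2.
pose p := double_comb_parent n w u.
have [n1 [w1 u1]] : 1 < n /\ w < n.-1 /\ u < n by lia.
have cn : c n != 0 by rewrite /c leq_pred.
(* Along the path, the excess of squares over edge products runs through 0, 1, 3, 2; each of the two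
   pendant vertices then contributes [1 - 2], for a total of 0. *)
have S k : k <= n.-1 -> \sum_(i < k) c i ^ 2 =
    \sum_(i < k) (if 0 < i then c i * c (p i) else 0) +
    (if k < lo then 0 else if k == lo then 1 else if k <= hi.+1 then 3 else 2).
  elim: k => [|k IH] kn; first by rewrite !big_ord0 /lo; case: ifP; lia.
  rewrite !big_ord_recr /= IH; last by lia.
  have -> : p k = k.-1.
    by rewrite /p /double_comb_parent /comb_parent; case: ifP => ?; try case: ifP => ?; lia.
  suff : (if k < lo then 0 else if k == lo then 1 else if k <= hi.+1 then 3 else 2) + c k ^ 2
    = (if 0 < k then c k * c k.-1 else 0) +
      (if k.+1 < lo then 0 else if k.+1 == lo then 1 else if k < hi.+1 then 3 else 2).
    by move=> H; rewrite -addnA H addnA.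
  have lo_hi : 0 < lo <= hi by lia.
  have hi_n : hi.+1 < n.-1 by lia.
  rewrite -mulnn /c; move: (lo) (hi) lo_hi hi_n => l h lh hn {IH cn c lab p}.
  by do ! (case: ifP => ?; try lia).
have := weakly_positive_tree W lab (double_comb_tree n1 w1 u1) (ex_intro2 _ _ n (ltnSn n) cn).
have [m nE] : exists m, n = m.+1 by exists n.-1; lia.
have cw : c w = 2 by rewrite /c /lo /hi; do ! (case: ifP => ?; try lia).
have cu : c u = 2 by rewrite /c /lo /hi; do ! (case: ifP => ?; try lia).
have cm : c n.-1 = 1 by rewrite /c leqnn.
have pn : p n = u by rewrite /p /double_comb_parent eqxx.
have pm : p n.-1 = w.
  by rewrite /p /double_comb_parent /comb_parent eqxx; case: ifP => // ?; lia.
have := S n.-1 (leqnn _); rewrite -/p; subst n; rewrite /= in S cw cu cm cn pn pm *.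
rewrite !big_ord_recr /= -/p pn pm cw cu cm => ->.
have -> : (if m < lo then 0 else if m == lo then 1 else if m <= hi.+1 then 3 else 2) = 2.
  by rewrite /lo /hi; do ! (case: ifP => ?; try lia).
have -> : 0 < m by lia.
have -> : c m.+1 = 1 by rewrite /c leqnSn.
by rewrite -[_ ^ 2]mulnn; lia.
Qed.

Lemma reverse_comb n w tau : w < n.-1 -> labelled G (comb_edge n w) n tau ->
  exists tau', labelled G (comb_edge n (n - 2 - w)) n tau'.
Proof.
move=> wn lab; pose rho i := if i < n.-1 then n - 2 - i else i.
exists (tau \o rho); apply: relabel lab _ _ _; rewrite /rho.
- by move=> i i8; case: ifP; lia.
- by move=> i j i8 j8; do 2! case: ifP; lia.
- move=> i j i8 j8; rewrite /comb_edge !path_edgeE /extra_edge.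
  by decide_atoms.
Qed.

(** After a reversal, the arm beyond [w] is the shorter one. Length 0 gives [A_n], length 1 gives
    [D_n], length 2 gives [E_n] or contains the extended [E_8], and longer ones contain the extended
    [E_7]. *)
Lemma comb_is_dynkin n w tau : w < n.-1 -> labelled G (comb_edge n w) n tau ->
  exists w' tau', [/\ w' < n.-1, comb_dynkin n w' & labelled G (comb_edge n w') n tau'].
Proof.
move=> wn; wlog le : w tau wn / n - 2 - w <= w.
  move=> IH lab; have [le|lt] := leqP (n - 2 - w) w; first exact: IH lab.
  by have [tau' lab'] := reverse_comb wn lab; apply: IH lab'; lia.
move=> lab; have [small|m2] := ltnP (n - 2 - w) 2.
  by exists w, tau; split => //; rewrite /comb_dynkin; lia.
have [m3|m3] := leqP 3 (n - 2 - w); first by case: (no_E7_tilde _ _ _ lab); lia.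
have [tau' lab'] := reverse_comb wn lab.
have m2E : n - 2 - w = 2 by lia.
rewrite m2E in lab'; exists 2, tau'; split => //; first by lia.
have [n9|n9] := leqP 9 n; first by case: (no_E8_tilde n9 lab').
by rewrite /comb_dynkin; lia.
Qed.

(** By the position of [u]: at an end of the path the path grows; if the comb is itself a path, [n]
    becomes its pendant vertex; an inner [u] gives an extended [D]; the pendant vertex gives [D]
    again or the extended [E_6]. *)
Lemma double_comb_is_dynkin n w u tau : w < n.-1 -> u < n -> comb_dynkin n w ->
  labelled G (double_comb_edge n w u) n.+1 tau ->
  exists w' tau', [/\ w' < n, comb_dynkin n.+1 w' & labelled G (comb_edge n.+1 w') n.+1 tau'].
Proof.
move=> wn un ok lab.
have [u0|u0] := posnP u.
  apply: (@comb_is_dynkin n.+1 w.+1 (tau \o fun i => if i == 0 then n else i.-1)) => //.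
    by rewrite /=; lia.
  apply: relabel lab _ _ _.
  - by move=> i i8; case: ifP; lia.
  - by move=> i j i8 j8; do 2! case: ifP; lia.
  - move=> i j i8 j8; rewrite /double_comb_edge /comb_edge !path_edgeE /extra_edge u0.
    by decide_atoms.
have [wE|wlt] : w = n - 2 \/ w < n - 2 by lia.
  apply: (@comb_is_dynkin n.+1 u tau); first by lia.
  rewrite -[tau]/(tau \o id); apply: relabel lab _ _ _ => // i j im jm.
  rewrite wE /double_comb_edge /comb_edge !path_edgeE /extra_edge.
  by decide_atoms.
have [inner|outer] := ltnP u (n - 2).
  by case: (@no_D_tilde n w u tau _ _ lab); move: ok; rewrite /comb_dynkin; lia.
have [uE|uE] : u = n - 2 \/ u = n.-1 by lia.
  pose rho i := if i < n.-1 then i else if i == n.-1 then n else n.-1.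
  apply: (@comb_is_dynkin n.+1 w (tau \o rho)); first by lia.
  apply: relabel lab _ _ _; rewrite /rho.
  - by move=> i im; case_ifs; lia.
  - by move=> i j im jm; case_ifs; lia.
  - move=> i j im jm; rewrite uE /double_comb_edge /comb_edge !path_edgeE /extra_edge.
    by decide_atoms.
have [wE|wE] : w = n - 3 \/ 5 < n /\ w = 2 by move: ok; rewrite /comb_dynkin; lia.
  (* The path is rerouted through the old pendant vertex to [n], and its old end [n - 2] becomes the
     pendant vertex. *)
  pose rho i := if i < n - 2 then i else if i == n then n - 2 else i.+1.
  apply: (@comb_is_dynkin n.+1 (n - 3) (tau \o rho)); first by lia.
  apply: relabel lab _ _ _; rewrite /rho.
  - by move=> i im; case_ifs; lia.
  - by move=> i j im jm; case_ifs; lia.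
  - move=> i j im jm; rewrite uE wE /double_comb_edge /comb_edge !path_edgeE /extra_edge.
    by decide_atoms.
by move: lab; rewrite uE (proj2 wE) => /no_E6_tilde; case; case: wE.
Qed.

End Grow.

Section Attach.
Variables (t : nat) (G : biquiver t).
Local Notation N := (n_arrows_between G).
Hypothesis W : tits_weakly_positive G.

Lemma sum_positive n : \sum_(i < n) (0 < i : nat) = n.-1.
Proof.
elim: n => [|n IH]; first by rewrite big_ord0.
by rewrite big_ord_recr /= IH; case: n {IH} => //= n; rewrite addn1.
Qed.

(** With all weights 1, weak positivity says that there are fewer edges than vertices: a loop, a
    double edge or a second edge to the tree would violate it. *)
Lemma attach_vertex E n p tau v u : labelled G E n tau -> tree_parent E n p ->
  (forall i, i < n -> tau i != v) -> u < n -> 0 < N v (tau u) ->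
  labelled G (fun i j => if (i == n) || (j == n) then extra_edge u n i j else E i j)
    n.+1 (fun i => if i == n then v else tau i).
Proof.
move=> lab tp new un adj; pose tau' i := if i == n then v else tau i.
have tau'E i : i < n -> tau' i = tau i by rewrite /tau' => ?; rewrite ltn_eqF.
have inj' : inj_below n.+1 tau'.
  move=> i j; rewrite /tau' !ltnS => im jm; have [inj _] := lab.
  case: eqP => [->|ni]; case: eqP => [->|nj] //.
  - by move=> E1; have := new j; rewrite -E1 eqxx; lia.
  - by move=> E1; have := new i; rewrite E1 eqxx; lia.
  - by apply: inj; lia.
have Nv0 : N v v = 0.
  have inj1 : inj_below 1 (fun=> v) by move=> [|i] [|j].
  have := weakly_positive_spread W inj1 (ex_intro2 _ (fun i => (fun=> 1) i != 0) 0 isT isT).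
  by rewrite !big_ord_recr !big_ord0 /= ltnS leqn0 !mul1n => /eqP.
have Nv1 : \sum_(j < n) N v (tau j) <= 1.
  have := weakly_positive_spread W inj'
    (ex_intro2 _ (fun i => (fun=> 1) i != 0) n (ltnSn n) isT).
  rewrite big_ord_recr [X in _ < X -> _]sum_nat_const card_ord /=.
  have tau'n : tau' n = v by rewrite /tau' eqxx.
  rewrite [\sum_(j < n.+1) _]big_ord_recr /= tau'n Nv0 muln0 addn0.
  have -> : \sum_(j < n) 1 * 1 * N v (tau' j) = \sum_(j < n) N v (tau j).
    by apply: eq_bigr => j _; rewrite tau'E // !mul1n.
  suff : n.-1 <= \sum_(i < n) \sum_(j < i.+1) 1 * 1 * N (tau' i) (tau' j).
    move=> H1 H2; rewrite -(leq_add2l n.-1) -ltnS.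
    apply: leq_ltn_trans (leq_add H1 (leqnn _)) _; apply: leq_trans H2 _.
    by rewrite exp1n; lia.
  rewrite -sum_positive.
  apply: leq_sum => i _; case: (posnP i) => // i0; have [pi pE] := tp.
  have pii : p i < i.+1 by rewrite ltnS ltnW // pi // i0 /=.
  have pn : p i < n by exact: leq_trans pii (ltn_ord i).
  have le : p i <= i by rewrite -ltnS.
  rewrite (bigD1 (Ordinal pii)) //= !tau'E // (proj2 lab _ _ (ltn_ord i) pn).
  by rewrite (pE _ _ le (ltn_ord i)) i0 eqxx.
have Nv j : j < n -> N v (tau j) = (j == u).
  move=> jn; move: Nv1; rewrite (bigD1 (Ordinal un)) //=.
  case: eqP => [->|ju]; first by lia.
  rewrite (bigD1 (Ordinal jn)) /=; first by lia.
  by rewrite -val_eqE; apply/eqP.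
split=> // i j im jm; rewrite /tau'.
have [->|ni] := eqVneq i n; have [->|nj] := eqVneq j n => /=.
- by rewrite Nv0 /extra_edge eqxx; lia.
- by rewrite Nv /extra_edge ?eqxx; lia.
- by rewrite n_arrows_sym Nv /extra_edge ?eqxx; lia.
- by rewrite (proj2 lab) //; lia.
Qed.
End Attach.

Section Classification.
Variables (t : nat) (G : biquiver t).
Local Notation N := (n_arrows_between G).
Hypothesis conn : connected_biquiver G.
Hypothesis W : tits_weakly_positive G.

Lemma und_adjE u v : und_adj G u v = (0 < N u v).
Proof.
apply/existsP/card_gt0P => [[a Ha]|[a Ha]]; exists a; first by rewrite inE.
by rewrite inE in Ha.
Qed.

(** Otherwise the image of [tau], which misses a vertex, would be closed under adjacency. *)
Lemma adjacent_outside n (tau : nat -> 'I_t) : 0 < n < t ->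
  exists v u, [/\ forall i, i < n -> tau i != v, u < n & 0 < N v (tau u)].
Proof.
move=> /andP[n0 nt]; pose S := [pred v | [exists i : 'I_n, tau i == v]].
have [v vS] : exists v, v \notin S.
  apply: NNPP => H; have sub : [set: 'I_t] \subset [set tau i | i : 'I_n].
    apply/subsetP => v _; have [vS|/negP vS] := boolP (v \in S); last first.
      by case: H; exists v; apply/negP.
    by case/existsP: vS => i /eqP <-; apply: imset_f.
  have := leq_trans (subset_leq_card sub) (leq_imset_card _ _).
  by rewrite cardsT !card_ord leqNgt nt.
apply: NNPP => H.
have cl : closed (und_adj G) S.
  suff cl1 x y : und_adj G x y -> x \in S -> y \in S.
    move=> x y xy; apply/idP/idP; apply: cl1 => //.
    by rewrite und_adjE n_arrows_sym -und_adjE.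
  move=> xy /existsP[i /eqP xi]; apply: contraT => yS; case: H.
  exists y, i; split=> // [j jn|]; last by rewrite n_arrows_sym -und_adjE xi.
  by apply: contra yS => yj; apply/existsP; exists (Ordinal jn).
have := closed_connect cl (proj2 conn (tau 0) v).
by rewrite (negPf vS) => /negbT/negP; case; apply/existsP; exists (Ordinal n0).
Qed.

Lemma grow_comb n : 1 < n <= t ->
  exists w tau, [/\ w < n.-1, comb_dynkin n w & labelled G (comb_edge n w) n tau].
Proof.
have t0 : 0 < t by case: conn.
elim: n => [//|[//|[|n]] IH] /andP[n1 nt].
  have lab1 : labelled G (fun _ _ => false) 1 (fun=> Ordinal t0).
    split=> [[|i] [|j] //|[|i] [|j] // _ _].
    have inj1 : inj_below 1 (fun=> Ordinal t0) by move=> [|i] [|j].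
    have := weakly_positive_spread W inj1 (ex_intro2 _ (fun i => (fun=> 1) i != 0) 0 isT isT).
    by rewrite !big_ord_recr !big_ord0 /= ltnS leqn0 !mul1n => /eqP.
  have tp1 : tree_parent (fun _ _ => false) 1 id.
    by split=> [[|i] //|[|i] [|j]].
  have [|v [u [new un adj]]] := @adjacent_outside 1 (fun=> Ordinal t0); first by rewrite nt.
  have lab2 := attach_vertex W lab1 tp1 new un adj.
  exists 0, ((fun i => if i == 1 then v else Ordinal t0) \o id); split=> //.
  apply: relabel lab2 _ _ _ => // i j i2 j2; rewrite /comb_edge path_edgeE /extra_edge.
  by case: i i2 => [|[|i]] //; case: j j2 => [|[|j]] //; case: u un adj.
have [|w [tau [wn ok lab]]] := IH; first by rewrite (ltnW nt).
have [|v [u [new un adj]]] := @adjacent_outside n.+2 tau; first by rewrite nt.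
have tp := comb_tree (isT : 1 < n.+2) wn.
have lab2 := attach_vertex W lab tp new un adj.
pose tau' i := if i == n.+2 then v else tau i.
apply: (@double_comb_is_dynkin _ _ W n.+2 w u (tau' \o id)) => //.
apply: relabel lab2 _ _ _ => // i j im jm.
rewrite /double_comb_edge /comb_edge !path_edgeE /extra_edge.
by decide_atoms.
Qed.

Lemma comb_dynkin_biquiver w tau : w < t.-1 -> comb_dynkin t w ->
  labelled G (comb_edge t w) t tau -> dynkin_biquiver G.
Proof.
move=> wt ok [inj lab].
pose f (i : 'I_t) := tau i.
have finj : injective f by move=> i j /inj E; apply: val_inj; apply: E.
have [g fK gK] := injF_bij finj.
suff [X okX XE] : exists2 X, dynkin_ok X t &
    forall i j, i < t -> j < t -> comb_edge t w i j = dynkin_edge X t i j.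
  exists X; split=> //; exists g; split; first by exists f.
  by move=> u v; rewrite -{1}(gK u) -{1}(gK v) /f lab // XE.
have [wA|[wD|wE]] : w = t - 2 \/ (3 < t /\ w = t - 3) \/ (w = 2 /\ 5 < t < 9).
  by move: ok; rewrite /comb_dynkin; lia.
- exists DynA; first by rewrite /=; lia.
  move=> i j im jm; rewrite wA /comb_edge /= !path_edgeE /extra_edge.
  by decide_atoms.
- by case: wD => t3 ->; exists DynD.
- rewrite (proj1 wE); have [t6|[t7|t8]] : t = 6 \/ t = 7 \/ t = 8 by lia.
  + by exists DynE6; rewrite //= t6.
  + by exists DynE7; rewrite //= t7.
  + by exists DynE8; rewrite //= t8.
Qed.

Lemma weakly_positive_dynkin : dynkin_biquiver G.
Proof.
have t0 : 0 < t by case: conn.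
have [t1|t1] := leqP t 1; last first.
  have [|w [tau [wt ok lab]]] := @grow_comb t; first by rewrite t1 /=.
  exact: comb_dynkin_biquiver wt ok lab.
exists DynA; split=> //; exists id; split; first by exists id.
move=> u v /=.
have -> : v = u by apply: val_inj => /=; have := ltn_ord u; have := ltn_ord v; lia.
have inj1 : inj_below 1 (fun=> u) by move=> [|i] [|j].
have := weakly_positive_spread W inj1 (ex_intro2 _ (fun i => (fun=> 1) i != 0) 0 isT isT).
rewrite !big_ord_recr !big_ord0 /= ltnS leqn0 !mul1n !add0n => /eqP ->.
by rewrite path_edgeE; lia.
Qed.
End Classification.

Local Open Scope ring_scope.

(** * Dynkin biquivers *)

Section Arms.
Variable C : numClosedFieldType.

(* The part of the Tits form carried by a path [z 0 - ... - z m], without [z 0 ^+ 2]. *)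
Definition arm m (z : nat -> C) := \sum_(i < m) (z i.+1 ^+ 2 - z i.+1 * z i).

Definition real_fun (z : nat -> C) := forall i, z i \is Num.real.

Lemma armS m z : arm m.+1 z = z 1%N ^+ 2 - z 1%N * z 0%N + arm m (z \o S).
Proof. by rewrite /arm big_ord_recl. Qed.

(** For fixed real [z 0] the minimum of [arm m z] is [- m / (2 * (m + 1)) * z 0 ^+ 2]; this
    completed square is the induction step for that bound. *)
Lemma armS_square m z : arm m.+1 z + m.+1%:R / (2 * m.+2%:R) * z 0%N ^+ 2 =
  m.+2%:R / (2 * m.+1%:R) * (z 1%N - m.+1%:R / m.+2%:R * z 0%N) ^+ 2 +
  (arm m (z \o S) + m%:R / (2 * m.+1%:R) * z 1%N ^+ 2).
Proof.
rewrite armS -[m.+2%:R]natr1 -[m.+1%:R]natr1.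
have m1 : m%:R + 1 != 0 :> C by rewrite natr1 pnatr_eq0.
have m2 : m%:R + 1 + 1 != 0 :> C by rewrite !natr1 pnatr_eq0.
by field; rewrite ?m1 ?m2.
Qed.

Lemma scaled_sqr_ge0 p q (x : C) : x \is Num.real -> 0 <= p%:R / (2 * q%:R) * x ^+ 2.
Proof.
move=> rx; apply: mulr_ge0; last exact: real_exprn_even_ge0.
by rewrite divr_ge0 // mulr_ge0.
Qed.

Lemma arm_bound m z : real_fun z -> 0 <= arm m z + m%:R / (2 * m.+1%:R) * z 0%N ^+ 2.
Proof.
elim: m z => [|m IH] z rz; first by rewrite /arm big_ord0 !mul0r addr0.
rewrite armS_square addr_ge0 //; last exact: (IH (z \o S) (fun i => rz _)).
apply: scaled_sqr_ge0; by rewrite rpredB // rpredM // rpred_div ?rpred_nat.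
Qed.

Lemma arm_eq0 m z : real_fun z -> z 0%N = 0 -> arm m z = 0 ->
  forall i, (i <= m)%N -> z i = 0.
Proof.
elim: m z => [|m IH] z rz z0 a0 [|i] //= im.
have := armS_square m z; rewrite a0 z0 expr0n /= mulr0 mulr0 addr0 subr0.
move/esym/eqP; have rzS : real_fun (z \o S) by move=> k; apply: rz.
rewrite paddr_eq0; last exact: (@arm_bound m _ rzS); last first.
  exact: scaled_sqr_ge0.
case/andP=> z1 /eqP a1; have {}z1 : z 1%N = 0.
  by move: z1; rewrite mulf_eq0 expf_eq0 /= mulf_eq0 invr_eq0 mulf_eq0 !pnatr_eq0 => /eqP.
move: a1; rewrite z1 expr0n mulr0 addr0 => a1.
exact: (IH (z \o S)).
Qed.

Lemma sum_path_arm w (c : nat -> C) :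
  \sum_(i < w.+1) (c i ^+ 2 - (if (0 < i)%N then c i * c i.-1 else 0)) =
  c w ^+ 2 + arm w (fun i => c (w - i)%N).
Proof.
elim: w => [|w IH].
  by rewrite big_ord_recr big_ord0 /arm big_ord0 /= subr0 add0r addr0.
rewrite big_ord_recr IH armS /= subSS subn0.
have -> : arm w ((fun i => c (w.+1 - i)%N) \o S) = arm w (fun i => c (w - i)%N) by [].
ring.
Qed.

Lemma comb_form_pos n w (c : nat -> C) : (1 < n)%N -> (w < n.-1)%N -> comb_dynkin n w ->
  real_fun c -> (exists2 i, (i < n)%N & c i != 0) ->
  0 < \sum_(i < n) (c i ^+ 2 - (if (0 < i)%N then c i * c (comb_parent n w i) else 0)).
Proof.
move=> n1 wn ok rc [i0 i0n ci0]; set Q := \sum_(i < n) _.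
have [m nE] : exists m, n = (w.+1 + m).+1%N by exists (n - 2 - w)%N; lia.
(* The three arms, all starting at the branch vertex [w]. *)
pose z1 i := c (w - i)%N; pose z2 i := c (w + i)%N.
pose z3 i := if i == 0%N then c w else c n.-1.
have [r1 r2] : real_fun z1 /\ real_fun z2 by split=> i; apply: rc.
have r3 : real_fun z3 by rewrite /z3 => i; case: ifP.
have QE : Q = c w ^+ 2 + arm w z1 + arm m z2 + arm 1 z3.
  rewrite /Q; have pn : comb_parent n w n.-1 = w by rewrite /comb_parent eqxx.
  have pE i : (i < w.+1 + m)%N -> comb_parent n w i = i.-1.
    by move=> lt; rewrite /comb_parent ifF //; lia.
  rewrite {}nE big_ord_recr /= big_split_ord /= in pn pE z3 r3 *.
  rewrite pn -sum_path_arm; congr (_ + _ + _).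
  - by apply: eq_bigr => i _; rewrite pE // ltn_addr.
  - apply: eq_bigr => i _; rewrite pE ?ltn_add2l //.
    by rewrite /z2 addSn addnS.
  - by rewrite /arm big_ord_recr big_ord0 /= add0r /z3.
pose k (m : nat) : C := m%:R / (2 * m.+1%:R).
(* The classical inequality [1/p + 1/q + 1/2 > 1] with [p = w + 1] and [q = m + 1]: the left side
   here is half of the difference. *)
have kap : 0 < 1 - k w - k m - k 1%N.
  have -> : 1 - k w - k m - k 1%N =
      ((2 * (w.+1 + m.+1))%N%:R - (w.+1 * m.+1)%N%:R) / (4 * w.+1%:R * m.+1%:R).
    rewrite /k !natrM natrD -[m.+1%:R]natr1 -[w.+1%:R]natr1.
    have mn : m%:R + 1 != 0 :> C by rewrite natr1 pnatr_eq0.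
    have wn' : w%:R + 1 != 0 :> C by rewrite natr1 pnatr_eq0.
    by field; rewrite ?mn ?wn'.
  rewrite divr_gt0 ?mulr_gt0 ?ltr0n // subr_gt0 ltr_nat.
  by move: ok; rewrite /comb_dynkin; nia.
have b1 := arm_bound w r1; have b2 := arm_bound m r2; have b3 := arm_bound 1 r3.
rewrite -/(k _) in b1 b2 b3.
have z10 : z1 0%N = c w by rewrite /z1 subn0.
have z20 : z2 0%N = c w by rewrite /z2 addn0.
have z30 : z3 0%N = c w by [].
have QE' : Q = (1 - k w - k m - k 1%N) * c w ^+ 2 + (arm w z1 + k w * z1 0%N ^+ 2)
    + (arm m z2 + k m * z2 0%N ^+ 2) + (arm 1 z3 + k 1%N * z3 0%N ^+ 2).
  by rewrite QE z10 z20 z30; ring.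
have c2 : 0 <= (1 - k w - k m - k 1%N) * c w ^+ 2.
  by apply: mulr_ge0 (ltW kap) _; apply: real_exprn_even_ge0.
have Q0 : 0 <= Q by rewrite QE'; do 3! (apply: addr_ge0 => //).
rewrite lt0r Q0 andbT QE'; apply: contraNneq ci0 => /eqP.
rewrite paddr_eq0 //; last by do 2! (apply: addr_ge0 => //).
rewrite paddr_eq0 //; last exact: addr_ge0.
rewrite paddr_eq0 // => /andP[/andP[/andP[cw a1] a2] a3].
have {cw} cw0 : c w = 0.
  by move: cw; rewrite mulf_eq0 (gt_eqF kap) expf_eq0 => /eqP.
move: a1 a2 a3; rewrite z10 z20 z30 cw0 expr0n /= !mulr0 !addr0.
move=> /eqP a1 /eqP a2 /eqP a3; apply/eqP.
have [iw|iw] := leqP i0 w.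
  by rewrite -(subKn iw); apply: (arm_eq0 r1 _ a1); rewrite /z1 ?subn0 // leq_subr.
have [im|im] := leqP i0 (w + m)%N.
  by rewrite -(subnKC (ltnW iw)); apply: (arm_eq0 r2 _ a2); rewrite /z2 ?addn0 //; lia.
have -> : i0 = n.-1 by lia.
by apply: (arm_eq0 r3 _ a3 (leqnn 1)); rewrite /z3.
Qed.
End Arms.

Section Dynkin.
Variables (t : nat) (G : biquiver t).
Local Notation N := (n_arrows_between G).
Hypothesis t0 : (0 < t)%N.

(** Combs have at least two vertices, hence the separate case of one vertex. The path [A_t] is the
    comb whose pendant vertex prolongs its path. *)
Lemma dynkin_labelled : dynkin_biquiver G ->
  (exists tau, t = 1%N /\ labelled G (fun _ _ => false) t tau) \/
  (exists w tau, [/\ (1 < t)%N, (w < t.-1)%N, comb_dynkin t w &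
     labelled G (comb_edge t w) t tau]).
Proof.
move=> [X [okX [s [sbij sE]]]]; have [g sK gK] := sbij.
pose tau i := g (insubd (Ordinal t0) i).
have stau i : (i < t)%N -> s (tau i) = i :> nat by move=> it; rewrite gK val_insubd it.
have inj : inj_below t tau.
  by move=> i j it jt /(congr1 (fun v => nat_of_ord (s v))); rewrite !stau.
have lab : labelled G (dynkin_edge X t) t tau.
  by split=> // i j it jt; rewrite sE !stau.
have [t1|t1] := leqP t 1.
  left; exists tau; have tE : t = 1%N by lia.
  split=> //; split=> // i j it jt; rewrite (proj2 lab) //.
  by case: X okX {sE lab} => /=; rewrite ?path_edgeE; lia.
right.
have [w [wt ok wE]] : exists w, [/\ (w < t.-1)%N, comb_dynkin t w &
    forall i j, (i < t)%N -> (j < t)%N -> dynkin_edge X t i j = comb_edge t w i j].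
  case: X okX {sE lab} => /= okX.
  - exists (t - 2)%N; split; rewrite /comb_dynkin; [lia|lia|] => i j im jm.
    by rewrite /comb_edge /= !path_edgeE /extra_edge; decide_atoms.
  - by exists (t - 3)%N; split; rewrite /comb_dynkin; [lia|lia|].
  - by exists 2%N; split; rewrite /comb_dynkin; [lia|lia|].
  - by exists 2%N; split; rewrite /comb_dynkin; [lia|lia|].
  - by exists 2%N; split; rewrite /comb_dynkin; [lia|lia|].
exists w, tau; split=> //; split=> // i j it jt.
by rewrite -wE //; apply: (proj2 lab).
Qed.

Lemma labelled_onto E tau : labelled G E t tau -> forall v, exists2 i, (i < t)%N & v = tau i.
Proof.
move=> [inj _] v; have finj : injective (fun i : 'I_t => tau i).
  by move=> i j /inj H; apply: val_inj; apply: H.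
by have [g _ gK] := injF_bij finj; exists (g v); rewrite ?gK.
Qed.

Lemma tits_form_labelled (C : numClosedFieldType) E p tau (x : 'I_t -> C) :
  labelled G E t tau -> tree_parent E t p ->
  tits_form G x = \sum_(i < t) (x (tau i) ^+ 2 -
    (if (0 < i)%N then x (tau i) * x (tau (p i)) else 0)).
Proof.
move=> lab tp; pose c i := x (tau i).
have xE v : x v = spread t tau c v.
  by have [i it ->] := labelled_onto lab v; rewrite spread_at //; case: lab.
rewrite sumrB -(tree_sum_arrows c lab tp) -(sum_spread_sqr (proj1 lab) c) /tits_form.
by congr (_ - _); apply: eq_bigr => i _; rewrite !xE.
Qed.

Lemma dynkin_pos_def (C : numClosedFieldType) : dynkin_biquiver G -> tits_pos_def C G.
Proof.
move=> /dynkin_labelled[[tau [tE lab]]|[w [tau [t1 wt ok lab]]]] x rx [v xv].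
  have tp : tree_parent (fun _ _ => false) t id.
    by split=> [i|i j ji it]; first lia; case: i ji it => //; lia.
  rewrite (tits_form_labelled x lab tp).
  have [i it vE] := labelled_onto lab v; rewrite vE in xv.
  rewrite (bigD1 (Ordinal it)) //= ifF ?subr0; last by lia.
  rewrite big1 ?addr0 => [|j /eqP ji].
    by rewrite lt0r expf_eq0 /= xv real_exprn_even_ge0.
  by case: ji; apply: val_inj => /=; have := ltn_ord j; lia.
rewrite (tits_form_labelled x lab (comb_tree t1 wt)).
have [i it vE] := labelled_onto lab v; rewrite vE in xv.
apply: (@comb_form_pos C t w (x \o tau)) => //; first by move=> k; apply: rx.
by exists i.
Qed.

(** From the root outwards, [s] is made to change exactly across the dashed edges; [dash i] tells
    whether the edge from [i] to its parent is dashed. *)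
Lemma tree_toggle E p tau : labelled G E t tau -> tree_parent E t p ->
  exists s : 'I_t -> bool, forall a, full G a (+) s (src G a) (+) s (tgt G a).
Proof.
move=> lab [pi pE]; have [inj NE] := lab.
pose dash i := [exists a : 'I_(narr G), ~~ full G a &&
  (((src G a == tau i) && (tgt G a == tau (p i))) ||
   ((src G a == tau (p i)) && (tgt G a == tau i)))].
have [s sE] : exists s : nat -> bool, forall i, (0 < i < t)%N -> s i = s (p i) (+) dash i.
  have H n : exists s : nat -> bool,
      forall i, (0 < i < t)%N -> (i < n)%N -> s i = s (p i) (+) dash i.
    elim: n => [|n [s sE]]; first by exists xpred0.
    exists (fun i => if i == n then s (p n) (+) dash n else s i) => i it.
    rewrite ltnS leq_eqVlt => /orP[/eqP iE|lt].
      by subst i; rewrite eqxx ltn_eqF ?pi.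
    by rewrite (ltn_eqF lt) (ltn_eqF (ltn_trans (pi _ it) lt)) sE.
  by have [s sE] := H t; exists s => i it; apply: sE => //; case/andP: it.
exists (fun v => s (index v [seq tau i | i <- iota 0 t])) => a.
have sv i : (i < t)%N -> index (tau i) [seq tau i | i <- iota 0 t] = i.
  move=> it; rewrite -{1}[i](nth_iota 0 0 it) -(nth_map _ (tau 0)) ?size_iota //.
  rewrite index_uniq ?size_map ?size_iota // map_inj_in_uniq ?iota_uniq // => k l.
  by rewrite !mem_iota /= add0n => kt lt; apply: inj.
have [i it iE] := labelled_onto lab (src G a); have [j jt jE] := labelled_onto lab (tgt G a).
rewrite iE jE !sv //.
have Nij : (0 < N (tau i) (tau j))%N.
  by apply/card_gt0P; exists a; rewrite inE iE jE !eqxx.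
have dashE k : (0 < k < t)%N ->
  (src G a = tau k /\ tgt G a = tau (p k)) \/ (src G a = tau (p k) /\ tgt G a = tau k) ->
  dash k = ~~ full G a.
  move=> /andP[k0 kt] ak.
  have N1 : N (tau k) (tau (p k)) = 1%N.
    have pk : (p k < k)%N by apply: pi; rewrite k0.
    by rewrite NE ?pE ?eqxx ?k0 ?(ltnW pk) // (ltn_trans pk).
  apply/existsP/idP => [[b /andP[fb bk]]|fa]; last first.
    by exists a; rewrite fa; case: ak => [[-> ->]|[-> ->]]; rewrite !eqxx ?orbT.
  suff -> : a = b by [].
  have /card_le1_eqP : (N (tau k) (tau (p k)) <= 1)%N by rewrite N1.
  by apply; rewrite inE //; case: ak => [[-> ->]|[-> ->]]; rewrite !eqxx ?orbT.
move: Nij; have [ij|ij] := leqP j i.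
  rewrite NE // pE //; rewrite lt0b => /andP[i0 /eqP jp].
  have it' : (0 < i < t)%N by rewrite i0.
  rewrite (sE i it') (dashE i it'); last by left; rewrite iE jE jp.
  by rewrite jp; case: (full G a); case: (s _).
rewrite n_arrows_sym NE // pE ?(ltnW ij) //; rewrite lt0b => /andP[j0 /eqP ip].
have jt' : (0 < j < t)%N by rewrite j0.
rewrite (sE j jt') (dashE j jt'); last by right; rewrite iE jE ip.
by rewrite ip; case: (full G a); case: (s _).
Qed.

Lemma dynkin_rep_finite (C : numClosedFieldType) : dynkin_biquiver G -> rep_finite C G.
Proof.
move=> dG; have pd : tits_pos_def C G := dynkin_pos_def dG.
have [b bd] := pos_def_roots_bounded pd.
have [s sG] : exists s : 'I_t -> bool, forall a, full G a (+) s (src G a) (+) s (tgt G a).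
  have [[tau [tE lab]]|[w [tau [t1 wt ok lab]]]] := dynkin_labelled dG.
    apply: (tree_toggle (p := id) lab).
    by split=> [i|i j ji it]; first lia; case: i ji it => //; lia.
  exact: tree_toggle lab (comb_tree t1 wt).
exact: toggle_rep_finite sG (pos_def_weakly_positive pd) bd.
Qed.
End Dynkin.

(** * Representation-finite biquivers are weakly positive *)

Lemma base_expansion_inj b n (f g : 'I_n -> nat) :
  (forall i, f i < b)%N -> (forall i, g i < b)%N ->
  (\sum_(i < n) f i * b ^ i = \sum_(i < n) g i * b ^ i)%N -> forall i, f i = g i.
Proof.
elim: n f g => [|n IH] f g fb gb; first by move=> _ [].
rewrite !big_ord_recl /= !expn0 !muln1.
have shift (h : 'I_n.+1 -> nat) : (\sum_(i < n) h (lift ord0 i) * b ^ bump 0 i =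
    (\sum_(i < n) h (lift ord0 i) * b ^ i) * b)%N.
  by rewrite big_distrl; apply: eq_bigr => i _ /=; rewrite expnSr mulnA.
rewrite !shift => E; have b0 : (0 < b)%N by apply: leq_ltn_trans (fb ord0).
have E0 : f ord0 = g ord0.
  by have := congr1 (modn^~ b) E; rewrite /= ![(_ + _ * b)%N]addnC !modnMDl !modn_small.
have E1 : (\sum_(i < n) f (lift ord0 i) * b ^ i = \sum_(i < n) g (lift ord0 i) * b ^ i)%N.
  by move/eqP: E; rewrite E0 eqn_add2l eqn_pmul2r // => /eqP.
move=> i; have [j ->|->] := unliftP ord0 i; last exact: E0.
by apply: (IH (fun j => f (lift ord0 j)) (fun j => g (lift ord0 j))).
Qed.

(** * Finitely many rational charts with too few parameters *)

Section Counting.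
Variable C : numFieldType.

Definition mdegree m (p : {mpoly C[m]}) := (msize p).-1.

Lemma mdegreeM m (p q : {mpoly C[m]}) : (mdegree (p * q) <= mdegree p + mdegree q)%N.
Proof.
rewrite /mdegree; have [->|p0] := eqVneq p 0; first by rewrite mul0r msize0.
have [->|q0] := eqVneq q 0; first by rewrite mulr0 msize0.
rewrite msizeM //; move: p0 q0; rewrite -!(mmeasure_poly_eq0 mdeg).
by move: (msize p) (msize q); lia.
Qed.

Lemma mdegreeX m (p : {mpoly C[m]}) k : (mdegree (p ^+ k) <= k * mdegree p)%N.
Proof.
elim: k => [|k IH]; first by rewrite /mdegree expr0 msize1.
by rewrite exprS mulSn (leq_trans (mdegreeM _ _)) // leq_add2l.
Qed.

Lemma mdegree_prod m (J : finType) (F : J -> {mpoly C[m]}) :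
  (mdegree (\prod_j F j) <= \sum_j mdegree (F j))%N.
Proof.
elim/big_ind2: _ => // [|p a q b pa qb]; first by rewrite /mdegree msize1.
by rewrite (leq_trans (mdegreeM _ _)) // leq_add.
Qed.

Lemma mcoeff_gt_degree m (p : {mpoly C[m]}) mu : (mdegree p < mdeg mu)%N -> p@_mu = 0.
Proof.
move=> H; apply: memN_msupp_eq0; apply: msize_mdeg_ge.
by move: H; rewrite /mdegree; case: (msize p).
Qed.

(* Kronecker substitution: powers of a single natural number separate the
   monomials of bounded degrees. *)
Lemma box_nonzero (J : finType) D (a : {ffun J -> 'I_D.+1} -> C) :
  (exists e, a e != 0) ->
  exists y : J -> nat, \sum_e a e * \prod_j (y j)%:R ^+ (e j) != 0.
Proof.
case=> e0 ae0; pose r (j : J) := enum_rank j.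
pose code (e : {ffun J -> 'I_D.+1}) := (\sum_(i < #|J|) e (enum_val i) * D.+1 ^ i)%N.
have code_inj : injective code.
  move=> e f /base_expansion_inj H; apply/ffunP => j; apply: val_inj.
  by rewrite -[j]enum_rankK; apply: H.
pose p := \sum_e a e *: 'X^(code e).
have p0 : p != 0.
  apply: contraNneq ae0 => p0; have := coef0 C (code e0); rewrite -p0 coef_sum.
  rewrite (bigD1 e0) //= coefZ coefXn eqxx mulr1 big1 ?addr0 => [->//|e ee0].
  by rewrite coefZ coefXn (inj_eq code_inj) eq_sym (negPf ee0) mulr0.
have [n pn] := poly_nonroot p0.
exists (fun j => (n ^ (D.+1 ^ r j))%N).
congr (_ != 0): pn; rewrite /p horner_sum; apply: eq_bigr => e _.
rewrite hornerZ hornerXn; congr (_ * _).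
rewrite -natrX /code -[X in (n ^ X)%N]/(\sum_(i < #|J|) _)%N.
rewrite expn_sum natr_prod (reindex (@enum_rank J)) /=; last first.
  by exists enum_val => ? _; [apply: enum_rankK | apply: enum_valK].
by apply: eq_bigr => j _; rewrite enum_rankK -natrX -expnM mulnC.
Qed.

(** For large [d] there are more monomials in [y] with exponents at most [d] than coefficients of
    their pullbacks to all the charts, denominators cleared. Hence a nonzero polynomial in [y]
    vanishes on every chart, and some natural point is not a zero of it. *)
Lemma charts_do_not_cover m (J K : finType) (N D : K -> J -> {mpoly C[m]}) :
  (m < #|J|)%N ->
  exists y : J -> nat, forall k (z : 'I_m -> C),
    (forall j, (D k j).@[z] != 0) -> ~ (forall j, (y j)%:R * (D k j).@[z] = (N k j).@[z]).
Proof.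
move=> mJ.
pose c := (\sum_k \sum_j (mdegree (N k j) + mdegree (D k j)))%N.
have cN k j : (mdegree (N k j) <= c)%N /\ (mdegree (D k j) <= c)%N.
  have : (mdegree (N k j) + mdegree (D k j) <= c)%N.
    rewrite /c (bigD1 k) //= (bigD1 j) //=; lia.
  lia.
(* Chosen so that [#|K| * T.+1 ^ m <= d * d.+1 ^ m < d.+1 ^ m.+1]. *)
pose d := (#|K| * (c * #|J|).+1 ^ m).+1.
pose T := (d * c * #|J|)%N.
pose A := {ffun J -> 'I_d.+1}.
(* The monomial [y ^ e] on the chart [k], multiplied by the [d]-th powers of all denominators. *)
pose P k (e : A) := \prod_j (N k j ^+ e j * D k j ^+ (d - e j)).
have degP k e : (mdegree (P k e) <= T)%N.
  apply: leq_trans (mdegree_prod _) _.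
  rewrite /T mulnC -sum_nat_const; apply: leq_sum => j _.
  have [Nc Dc] := cN k j; apply: leq_trans (mdegreeM _ _) _.
  have := mdegreeX (N k j) (e j); have := mdegreeX (D k j) (d - e j).
  have := ltn_ord (e j); nia.
pose B := (K * {ffun 'I_m -> 'I_T.+1})%type.
pose mon (f : {ffun 'I_m -> 'I_T.+1}) : 'X_{1..m} := [multinom (f i : nat) | i < m].
(* Rows are exponents [e]; columns are the coefficients of [P k e] over all charts. With more rows
   than columns, there is a linear relation. *)
pose M : 'M[C]_(#|{: A}|, #|{: B}|) :=
  \matrix_(i, j) (P (enum_val j).1 (enum_val i))@_(mon (enum_val j).2).
have cardAB : (#|{: B}| < #|{: A}|)%N.
  have le_exp x y k : (x <= y -> x ^ k <= y ^ k)%N by case: k => // k xy; rewrite leq_exp2r.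
  rewrite card_prod !card_ffun !card_ord.
  apply: (@leq_ltn_trans (d * d.+1 ^ m)).
    apply: (@leq_trans (#|K| * (c * #|J|).+1 ^ m * d.+1 ^ m)); last first.
      by rewrite leq_mul2r leqnSn orbT.
    rewrite -mulnA leq_mul2l -expnMn; apply/orP; right.
    by apply: le_exp; rewrite /T; nia.
  apply: (@leq_trans (d.+1 ^ m.+1)); last by rewrite leq_exp2l.
  by rewrite expnS ltn_pmul2r ?expn_gt0.
have [r rM r0] : exists2 r : 'rV_#|{: A}|, r *m M = 0 & r != 0.
  have : kermx M != 0.
    rewrite -mxrank_eq0 mxrank_ker -lt0n subn_gt0.
    by apply: leq_ltn_trans cardAB; apply: rank_leq_col.
  move/rowV0Pn => [r rK r0]; exists r => //; exact/sub_kermxP.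
pose a (e : A) := r 0 (enum_rank e).
have [y ynz] : exists y : J -> nat, \sum_e a e * \prod_j (y j)%:R ^+ (e j) != 0.
  apply: box_nonzero; apply: NNPP => H; case/eqP: r0; apply/rowP => i; rewrite mxE.
  apply/eqP/negPn/negP => ri; apply: H; exists (enum_val i).
  by rewrite /a enum_valK.
exists y => k z Dz yz; case/eqP: ynz.
have Q0 : \sum_e a e *: P k e = 0.
  apply/mpolyP => mu; rewrite mcoeff0 raddf_sum /=.
  have [/forallP small|/forallPn[i big]] := boolP [forall i, mu i < T.+1]%N; last first.
    rewrite big1 // => e _; rewrite mcoeffZ mcoeff_gt_degree ?mulr0 //.
    apply: leq_ltn_trans (degP k e) _; rewrite mdegE (bigD1 i) //=.
    by apply: ltn_addr; rewrite ltnNge.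
  pose f : {ffun 'I_m -> 'I_T.+1} := [ffun i => inord (mu i)].
  have monf : mon f = mu by apply/mnmP => i; rewrite mnmE ffunE inordK.
  have /rowP/(_ (enum_rank ((k, f) : B))) := rM; rewrite !mxE => rE; apply: etrans _ rE.
  rewrite [RHS](reindex (@enum_rank A)) /=; last first.
    by exists enum_val => ? _; [apply: enum_rankK | apply: enum_valK].
  by apply: eq_bigr => e _; rewrite mcoeffZ !mxE !enum_rankK /= monf.
have := congr1 (meval z) Q0; rewrite meval0 raddf_sum /=.
pose u := \prod_j (D k j).@[z] ^+ d.
have u0 : u != 0 by apply/prodf_neq0 => j _; rewrite expf_neq0.
move=> E; apply: (mulIf u0); rewrite mul0r -[RHS]E mulr_suml; apply: eq_bigr => e _.
rewrite mevalZ -mulrA; congr (_ * _); rewrite /u -big_split /P rmorph_prod /=.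
apply: eq_bigr => j _.
rewrite /= rmorphM !rmorphXn /= -yz exprMn -mulrA -exprD subnKC //.
by rewrite -ltnS.
Qed.
End Counting.

Section FiniteTypeBound.
Variables (C : numClosedFieldType) (t : nat) (G : biquiver t).
Implicit Types A B : rep C G.

Lemma rep_iso_trans A B K : rep_iso A B -> rep_iso B K -> rep_iso A K.
Proof.
case=> F [mF /fin_all_exists[F' FE]] [H [mH /fin_all_exists[H' HE]]].
exists (fun v => H v *m F v); split=> [a|v].
  rewrite -[RHS]mulmxA -mF [RHS]mulmxA -mH -mulmxA.
  by case: (full G a); rewrite ?conj_mxM.
exists (F' v *m H' v); have [F1 F2] := FE v; have [H1 H2] := HE v.
by rewrite -!mulmxA (mulmxA (H' v)) H1 mul1mx (mulmxA (F v)) F2 mul1mx.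
Qed.

Lemma rep_iso_sym A B : rep_iso A B -> rep_iso B A.
Proof.
case=> F [mF /fin_all_exists[H HE]]; exists H; split => [a|v]; last first.
  by exists (F v); case: (HE v).
have [HF _] := HE (tgt G a); have [_ FH] := HE (src G a).
rewrite -[LHS]mul1mx -HF -mulmxA (mulmxA (F _)) -mF -!mulmxA.
suff -> : (if full G a then F (src G a) else conj_mx (F (src G a))) *m
    (if full G a then H (src G a) else conj_mx (H (src G a))) = 1%:M by rewrite mulmx1.
by case: (full G a); rewrite -?conj_mxM FH ?conj_mx1.
Qed.

Lemma rep_iso_dsum A A' B B' :
  rep_iso A A' -> rep_iso B B' -> rep_iso (rep_dsum A B) (rep_dsum A' B').
Proof.
case=> F [mF /fin_all_exists[F' FE]] [H [mH /fin_all_exists[H' HE]]].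
exists (fun v => block_mx (F v) 0 0 (H v)); split=> [a|v].
  have -> : (if full G a then block_mx (F (src G a)) 0 0 (H (src G a))
      else conj_mx (block_mx (F (src G a)) 0 0 (H (src G a)))) =
    block_mx (if full G a then F (src G a) else conj_mx (F (src G a))) 0 0
      (if full G a then H (src G a) else conj_mx (H (src G a))).
    by case: (full G a); rewrite // /conj_mx map_block_mx !map_mx0.
  apply: etrans (mulmx_block _ _ _ _ _ _ _ _) _.
  apply: etrans _ (esym (mulmx_block _ _ _ _ _ _ _ _)).
  by rewrite mF mH !mulmx0 !mul0mx !addr0 !add0r.
exists (block_mx (F' v) 0 0 (H' v)); have [F1 F2] := FE v; have [H1 H2] := HE v.
split; apply: etrans (mulmx_block _ _ _ _ _ _ _ _) _;
  by rewrite ?F1 ?F2 ?H1 ?H2 !mulmx0 !mul0mx !addr0 !add0r -scalar_mx_block.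
Qed.

(** Induction on the bound: a representation is zero, indecomposable, or a sum of two of smaller
    total dimension. *)
Lemma rep_finite_bounded_dim : rep_finite C G -> forall n,
  exists (K : finType) (f : K -> rep C G),
    forall A, (\sum_v rdim A v <= n)%N -> exists k, rep_iso A (f k).
Proof.
move=> [m [f fE]]; elim=> [|n [K [g gE]]].
  exists unit, (fun=> @Rep C t G (fun=> 0%N) (fun=> 0)) => A.
  rewrite leqn0 sum_nat_eq0 => /forallP A0; exists tt.
  have dA v : rdim A v = 0%N by apply/eqP; apply: (implyP (A0 v)).
  exists (fun v => 0); split=> [a|v].
    by apply/matrixP => [] [].
  exists 0; split; apply/matrixP => i; last by case: i.
  by have := leq_trans (ltn_ord i) (eq_leq (dA v)).
exists (K + 'I_m + K * K)%type.
exists (fun k => match k with inl (inl k) => g k | inl (inr i) => f i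
  | inr (k, l) => rep_dsum (g k) (g l) end) => A An.
have [iA|niA] := classic (indecomposable A).
  by have [i Ai] := fE A iA; exists (inl (inr i)).
have [nzA|zA] := classic (rep_nonzero A); last first.
  have [|k kE] := gE A; last by exists (inl (inl k)).
  rewrite big1 // => v _; apply/eqP/negPn/negP => Av; apply: zA; by exists v.
have [B [B' [nB [nB' AB]]]] : exists B B', rep_nonzero B /\ rep_nonzero B' /\
    rep_iso A (rep_dsum B B') by apply: NNPP => H; apply: niA.
have dAB : (\sum_v rdim A v = \sum_v rdim B v + \sum_v rdim B' v)%N.
  rewrite -big_split; apply: eq_bigr => v _ /=.
  case: AB => F [_ /(_ v) [Fi [F1 F2]]].
  have r1 := mulmx1_min F1; have r2 := mulmx1_min F2.
  by apply/eqP; rewrite eqn_leq r1 r2.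
have pos (D : rep C G) : rep_nonzero D -> (0 < \sum_v rdim D v)%N.
  by case=> v Dv; rewrite (bigD1 v) //= ltn_addr // lt0n.
have pB := pos _ nB; have pB' := pos _ nB'.
have [|k kE] := gE B; first by lia.
have [|l lE] := gE B'; first by lia.
exists (inr (k, l)); exact: rep_iso_trans AB (rep_iso_dsum kE lE).
Qed.

(** Each class on the list that contains representations over [d] itself gets such a representative;
    the others get a zero default. *)
Lemma rep_finite_fixed_dim (d : 'I_t -> nat) : rep_finite C G ->
  exists (K : finType) (f : K -> maps C G d), forall B : maps C G d, exists k,
    rep_iso (@Rep C t G d (f k)) (@Rep C t G d B).
Proof.
move=> /rep_finite_bounded_dim/(_ (\sum_v d v)%N)[K [f fE]].
have H k : exists m : maps C G d, forall B : maps C G d,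
    rep_iso (@Rep C t G d B) (f k) -> rep_iso (@Rep C t G d m) (f k).
  have [[B iB]|nB] := classic (exists B : maps C G d, rep_iso (@Rep C t G d B) (f k)).
    by exists B.
  by exists (fun=> 0) => B iB; case: nB; exists B.
have [m mE] := fin_all_exists H; exists K, m => B.
have [k kE] := fE (@Rep C t G d B) (leqnn _); exists k.
exact: rep_iso_trans (mE k B kE) (rep_iso_sym kE).
Qed.
End FiniteTypeBound.

(** * Rational parametrization of the orbits *)

Section Tits.
Variables (C : numClosedFieldType) (t : nat) (G : biquiver t).
Variable d : 'I_t -> nat.

(* Real coordinates: each complex entry has a real part (tag [false]) and an
   imaginary part (tag [true]). *)
Local Notation I := (entry_index d d * bool)%type.
Local Notation J :=
  (entry_index (fun a : 'I_(narr G) => d (tgt G a)) (fun a => d (src G a)) * bool)%type.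

Definition coord v (i j : 'I_(d v)) b : I :=
  (Tagged (fun v => 'I_(d v) * 'I_(d v))%type (i, j), b).

Definition real_maps (y : J -> C) : maps C G d := fun a => \matrix_(i, j)
  (y (Tagged (fun a => 'I_(d (tgt G a)) * 'I_(d (src G a)))%type (i, j), false) +
   'i * y (Tagged (fun a => 'I_(d (tgt G a)) * 'I_(d (src G a)))%type (i, j), true)).


Section Chart.
Variables (P : comNzRingType) (cst : {rmorphism C -> P}) (var : I -> P) (f : maps C G d).

(** Conjugation is not polynomial in complex entries, so real and imaginary parts are the variables
    and the conjugate is a second matrix. *)
Definition generic v : 'M[P]_(d v) :=
  \matrix_(i, j) (var (coord i j false) + cst 'i * var (coord i j true)).
Definition generic_conj v : 'M[P]_(d v) :=
  \matrix_(i, j) (var (coord i j false) - cst 'i * var (coord i j true)).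

Definition generic_src a := if full G a then generic (src G a) else generic_conj (src G a).
Definition generic_src_conj a := if full G a then generic_conj (src G a) else generic (src G a).

(** The adjugate replaces the inverse to stay polynomial: at an isomorphism the value is the target
    map times the determinant of the source factor. *)
Definition chart_mat a := generic (tgt G a) *m map_mx cst (f a) *m \adj (generic_src a).
Definition chart_mat_conj a :=
  generic_conj (tgt G a) *m map_mx cst (conj_mx (f a)) *m \adj (generic_src_conj a).

(* If [x] are the coordinates of an isomorphism from [f] to the representation
   with real coordinates [y], then [y j * chart_den j = chart_num j] at [x], by
   Cramer's rule. *)
Definition chart_num (j : J) : P :=
  let a := tag j.1 in let p := tagged j.1 in
  if j.2 then chart_mat a p.1 p.2 * \det (generic_src_conj a) -
              chart_mat_conj a p.1 p.2 * \det (generic_src a)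
  else chart_mat a p.1 p.2 * \det (generic_src_conj a) +
       chart_mat_conj a p.1 p.2 * \det (generic_src a).
(** The factors 2 and [2 * 'i] come from extracting real and imaginary parts as half-sums and
    half-differences with the conjugate. *)
Definition chart_den (j : J) : P :=
  cst (2 * (if j.2 then 'i else 1)) * \det (generic_src (tag j.1)) *
    \det (generic_src_conj (tag j.1)).

Lemma chart_eval (ev : {rmorphism P -> C}) (y : J -> C) (F : forall v, 'M[C]_(d v)) (x : I -> C) :
  (forall c, ev (cst c) = c) -> (forall i, ev (var i) = x i) ->
  (forall j, y j \is Num.real) -> (forall i, x i \is Num.real) ->
  (forall v i j, F v i j = x (coord i j false) + 'i * x (coord i j true)) ->
  (forall v, F v \in unitmx) ->
  is_morphism (F : fam (@Rep C t G d f) (@Rep C t G d (real_maps y))) ->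
  forall j, ev (chart_den j) != 0 /\ y j * ev (chart_den j) = ev (chart_num j).
Proof.
move=> evc evx ry rx Fx Fu mF.
have gE v : map_mx ev (generic v) = F v.
  by apply/matrixP => i j; rewrite !mxE rmorphD rmorphM /= evc !evx Fx.
have gcE v : map_mx ev (generic_conj v) = conj_mx (F v).
  apply/matrixP => i j; rewrite !mxE rmorphB rmorphM /= evc !evx Fx.
  by rewrite rmorphD rmorphM /= conjCi !conj_Creal // mulNr.
have cE p q (M : 'M[C]_(p, q)) : map_mx ev (map_mx cst M) = M.
  by apply/matrixP => i j; rewrite !mxE evc.
pose H a := if full G a then F (src G a) else conj_mx (F (src G a)).
have sE a : map_mx ev (generic_src a) = H a.
  by rewrite /generic_src /H; case: ifP => _; [apply: gE | apply: gcE].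
have scE a : map_mx ev (generic_src_conj a) = conj_mx (H a).
  rewrite /generic_src_conj /H; case: ifP => _; first exact: gcE.
  by rewrite conj_mxK; apply: gE.
have conj_det n (M : 'M[C]_n) : \det (conj_mx M) = (\det M)^* by rewrite det_map_mx.
have detH a : \det (H a) != 0.
  have du v : \det (F v) != 0 by rewrite -unitfE -unitmxE.
  by rewrite /H; case: ifP => _ //; rewrite conj_det conjC_eq0.
have numE a : map_mx ev (chart_mat a) = \det (H a) *: real_maps y a.
  rewrite /chart_mat !map_mxM map_mx_adj gE cE sE.
  by have /= <- := mF a; rewrite -mulmxA mul_mx_adj mul_mx_scalar.
have numcE a : map_mx ev (chart_mat_conj a) = conj_mx (\det (H a) *: real_maps y a).
  rewrite -numE /chart_mat_conj /chart_mat !map_mxM !map_mx_adj gE gcE !cE sE scE.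
  by rewrite !conj_mxM /conj_mx map_mx_adj.
move=> [[a [p q]] b]; rewrite /chart_den /chart_num /=.
have dE : ev (\det (generic_src a)) = \det (H a) by rewrite -det_map_mx sE.
have dcE : ev (\det (generic_src_conj a)) = (\det (H a))^*.
  by rewrite -det_map_mx scE conj_det.
have nE : ev (chart_mat a p q) = \det (H a) * real_maps y a p q.
  by have /matrixP/(_ p q) := numE a; rewrite !mxE.
have ncE : ev (chart_mat_conj a p q) = (\det (H a))^* * (real_maps y a p q)^*.
  by have /matrixP/(_ p q) := numcE a; rewrite !mxE rmorphM.
split.
  rewrite !rmorphM /= dE dcE !evc !mulf_neq0 ?conjC_eq0 ?pnatr_eq0 //.
  by case: b; rewrite ?neq0Ci ?oner_eq0.
rewrite !rmorphM /= !evc dE dcE.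
case: b; rewrite ?rmorphB ?rmorphD !rmorphM /= nE ncE dE dcE /real_maps !mxE;
  rewrite rmorphD rmorphM /= conjCi !(conj_Creal (ry _)); ring.
Qed.
End Chart.

Section Normalization.
Variables (m : nat) (i0 : I).
Hypothesis card_I : #|{: I}| = m.+1.

(** When [I] has [m.+1] elements, every index other than that of [i0] falls below [m], so the
    default [0] is not reached. *)
Definition chart_var (i : I) : {mpoly C[m]} :=
  if i == i0 then 1 else
  oapp (fun k : 'I_m => 'X_k) 0 (insub (index i (enum (predC1 i0)))).

Lemma chart_var_eval (x : I -> C) : x i0 = 1 ->
  exists z : 'I_m -> C, forall i, meval z (chart_var i) = x i.
Proof.
move=> x1; have sz : size (enum (predC1 i0)) = m.
  by rewrite -cardE; apply: succn_inj; rewrite -card_I (cardC1 i0) prednK // card_I.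
exists (fun k => x (nth i0 (enum (predC1 i0)) k)) => i; rewrite /chart_var.
case: eqP => [->|/eqP ni]; first by rewrite meval1.
have mi : i \in enum (predC1 i0) by rewrite mem_enum inE.
have lt : (index i (enum (predC1 i0)) < m)%N by rewrite -[X in (_ < X)%N]sz index_mem.
by rewrite insubT /= mevalXU /= nth_index.
Qed.
End Normalization.

(** A real scalar passes through the conjugation at dashed arrows, so an isomorphism may be divided
    by one of its nonzero real coordinates. *)
Lemma normalize_iso (f B : maps C G d) : (exists v, d v != 0%N) ->
  rep_iso (@Rep C t G d f) (@Rep C t G d B) ->
  exists (i0 : I) (x : I -> C) (F : forall v, 'M[C]_(d v)),
    [/\ x i0 = 1, forall i, x i \is Num.real,
      forall v i j, F v i j = x (coord i j false) + 'i * x (coord i j true),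
      forall v, F v \in unitmx &
      is_morphism (F : fam (@Rep C t G d f) (@Rep C t G d B))].
Proof.
move=> [v0 dv0] [F [mF Finv]]; rewrite /= in F mF Finv.
pose u (i : I) : C := let p := tagged i.1 in
  if i.2 then 'Im (F (tag i.1) p.1 p.2) else 'Re (F (tag i.1) p.1 p.2).
have ur i : u i \is Num.real by rewrite /u; case: ifP => _; rewrite ?Creal_Im ?Creal_Re.
have [i0 ui0] : exists i0, u i0 != 0.
  apply: NNPP => H; have F0 : F v0 = 0.
    apply/matrixP => i j; rewrite mxE [F v0 i j]Crect.
    have u0 b : u (coord i j b) = 0.
      by apply/eqP/negPn/negP => ub; apply: H; exists (coord i j b).
    by have := u0 false; have := u0 true; rewrite /u /= => -> ->; rewrite mulr0 addr0.
  have [Fi [_ F1]] := Finv v0; move/eqP: F1; rewrite F0 mul0mx eq_sym.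
  by rewrite -mxrank_eq0 mxrank1 (negPf dv0).
have rr : (u i0)^-1 \is Num.real by rewrite rpredV.
exists i0, (fun i => (u i0)^-1 * u i), (fun v => (u i0)^-1 *: F v); split.
- by rewrite mulVf.
- by move=> i; rewrite rpredM.
- by move=> v i j; rewrite mxE {1}[F v i j]Crect /u /=; ring.
- move=> v; have [Fi [_ F1]] := Finv v.
  rewrite unitmxZ ?unitfE ?invr_eq0 //; by case/mulmx1_unit: F1.
- move=> a; have /= := mF a; case: ifP => _ E.
    by rewrite -scalemxAr E scalemxAl.
  rewrite /conj_mx map_mxZ /= (conj_Creal rr) -scalemxAr.
  by rewrite -/(conj_mx _) E scalemxAl.
Qed.
End Tits.

Lemma rep_finite_weakly_positive (C : numClosedFieldType) t (G : biquiver t) :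
  rep_finite C G -> tits_weakly_positive G.
Proof.
move=> fin d dnz; rewrite ltnNge; apply/negP => le.
have [K [f fE]] := rep_finite_fixed_dim d fin.
set I := (entry_index d d * bool)%type.
set J := (entry_index (fun a : 'I_(narr G) => d (tgt G a)) (fun a => d (src G a)) * bool)%type.
have cI : #|{: I}| = (2 * \sum_v d v ^ 2)%N.
  by rewrite card_prod card_bool card_entry_index mulnC.
have cJ : #|{: J}| = (2 * \sum_(a < narr G) d (src G a) * d (tgt G a))%N.
  rewrite card_prod card_bool card_entry_index mulnC; congr (_ * _)%N.
  by apply: eq_bigr => a _; rewrite mulnC.
have I0 : (0 < #|{: I}|)%N.
  have [v dv] := dnz; rewrite cI (bigD1 v) //= muln_gt0 /=.
  by rewrite ltn_addr // expn_gt0 lt0n dv.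
have [m mE] : exists m, #|{: I}| = m.+1 by exists #|{: I}|.-1; rewrite prednK.
(* Normalization saves one parameter, which makes the inequality strict even when [q d = 0]. *)
have mJ : (m < #|{: J}|)%N by rewrite cJ -mE cI leq_mul2l.
(* One chart for each representative [k.1] and each coordinate [k.2] that may be normalized to 1. *)
pose N (k : K * I) (j : J) := chart_num (@mpolyC m C) (@chart_var C t d m k.2) (f k.1) j.
pose D (k : K * I) (j : J) := chart_den (G := G) (@mpolyC m C) (@chart_var C t d m k.2) j.
have [y yE] := @charts_do_not_cover C m J _ N D mJ.
pose yC (j : J) : C := (y j)%:R.
have ry j : yC j \is Num.real by rewrite realn.
have [k kE] := fE (real_maps yC).
have [i0 [x [F [x1 rx Fx Fu mF]]]] := normalize_iso dnz kE.
have [z zE] := chart_var_eval mE x1.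
have ev j := @chart_eval C t G d {mpoly C[m]} (@mpolyC m C) (@chart_var C t d m i0) (f k)
  (meval z) yC F x (mevalC z) zE ry rx Fx Fu mF j.
by apply: (yE (k, i0) z) => j; case: (ev j).
Qed.

Theorem theorem1 (C : numClosedFieldType) (t : nat) (G : biquiver t) :
  connected_biquiver G ->
  (rep_finite C G <-> dynkin_biquiver G) /\ (dynkin_biquiver G <-> tits_pos_def C G).
Proof.
move=> conn; have t0 : (0 < t)%N by case: conn.
split; split.
- by move/rep_finite_weakly_positive; apply: weakly_positive_dynkin.
- exact: dynkin_rep_finite.
- exact: dynkin_pos_def.
- by move/pos_def_weakly_positive; apply: weakly_positive_dynkin.
Qed.
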